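(* Let $X$ be a finite affinely independent subset of $\mathbb{R}^k$ and let $d$ be a positive integer. Then there exists $n=n(X,d)$ such that for every continuous map $f\colon\mathbb{R}^n\to\mathbb{R}^d$ there exists an isometric image $X'\subset\mathbb{R}^n$ of $X$ (a set $X'$ with a distance-preserving bijection $X\to X'$) on which $f$ is constant. *)

(* Defs.v *)
From HB Require Import structures.
From mathcomp Require Import all_boot all_order all_algebra.
From mathcomp Require Import all_classical all_reals all_analysis.
Set Implicit Arguments. Unset Strict Implicit. Unset Printing Implicit Defensive.
Import Order.TTheory GRing.Theory Num.Theory.
Import numFieldNormedType.Exports.
Local Open Scope ring_scope.

Definition eucl_dist (R : realType) (k : nat) (x y : 'rV[R]_k) : R :=
  Num.sqrt (\sum_(i < k) (x ord0 i - y ord0 i) ^+ 2).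

Definition affinely_independent (R : realType) (k : nat) (X : seq 'rV[R]_k) :=
  uniq X /\
  forall c : 'I_(size X) -> R,
    \sum_(i < size X) c i = 0 ->
    \sum_(i < size X) c i *: X`_i = 0 ->
    forall i, c i = 0.

(* Main.v *)
Require Import Defs.
From HB Require Import structures.
From mathcomp Require Import all_boot all_order all_algebra.
From mathcomp Require Import all_classical all_reals all_analysis.
From mathcomp Require Import ring lra zify.
Set Implicit Arguments. Unset Strict Implicit. Unset Printing Implicit Defensive.
Import Order.TTheory GRing.Theory Num.Theory.
Import numFieldNormedType.Exports.
Local Open Scope ring_scope.

(* The simplex X embeds isometrically in an orbit of a cyclic group Z/q of prime
   order acting linearly by isometries. Affine independence puts the squared
   distances of X in the interior of the cone of Euclidean squared distances, so
   they can be matched up to a nearly constant positive remainder by finitely many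
   metrics 2 - 2 cos (2 pi tau t / q) on Z/q, once the vertices are sent to the
   powers of a large base B; the remainder is then realized exactly, because the
   differences B^i - B^j determine the pair (i, j).

   The copies of the orbit contain a copy of the join E of N + 1 copies of Z/q,
   on which Z/q acts freely, and f restricted to them gives h : E -> R^d. If h
   were constant on no Z/q-orbit, a gap in the values of some coordinate of h
   along the orbit of x would give an equivariant label in (Z/q) * {1..N} with
   N = d q such that near points of E with the same index have the same label. On
   a fine subdivision of E this is an equivariant chain map from the N-skeleton of
   the periodic resolution of Z/q to the chains of a free complex of dimension
   N - 1, which is impossible mod q. The last step is carried out dually, by
   lifting the augmentation cocycle on labels step by step up to degree N, where it
   vanishes, while its value on the fundamental chain of E remains 1. *)

(** * Cochains and the periodic resolution of Z/q *)

Section Cochains.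
Variable A : comNzRingType.

(* Cochains are arbitrary functions on lists of vertices; the empty list is
   the unique simplex of dimension -1, so [cobd] is the augmented coboundary. *)
Fixpoint cobd (V : Type) (phi : seq V -> A) (s : seq V) : A :=
  if s is x :: s' then phi s' - cobd (fun t => phi (x :: t)) s' else 0.

Lemma eq_cobd (V : eqType) (phi psi : seq V -> A) (s : seq V) :
  (forall t, (size t).+1 = size s -> {subset t <= s} -> phi t = psi t) ->
  cobd phi s = cobd psi s.
Proof.
elim: s phi psi => //= x s IH phi psi e; congr (_ - _).
  by apply: e => // y ys; rewrite inE ys orbT.
apply: IH => t st ts; apply: e => /=; first by rewrite st.
by move=> y; rewrite !inE => /orP[->//|/ts ->]; rewrite orbT.
Qed.

Lemma cobd_sub (V : Type) (phi psi : seq V -> A) s :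
  cobd (fun t => phi t - psi t) s = cobd phi s - cobd psi s.
Proof.
elim: s phi psi => /= [|x s IH] phi psi; first by rewrite subrr.
by rewrite IH; ring.
Qed.

Lemma cobd_opp (V : Type) (phi : seq V -> A) s :
  cobd (fun t => - phi t) s = - cobd phi s.
Proof.
elim: s phi => /= [|x s IH] phi; first by rewrite oppr0.
by rewrite (IH (fun t => phi (x :: t))); ring.
Qed.

Lemma cobd_sum (V : Type) (I : finType) (w : I -> A) (phi : I -> seq V -> A) s :
  cobd (fun t => \sum_i w i * phi i t) s = \sum_i w i * cobd (phi i) s.
Proof.
elim: s phi => /= [|x s IH] phi.
  by rewrite big1 // => i _; rewrite mulr0.
by rewrite IH -sumrB; apply: eq_bigr => i _; rewrite mulrBr.
Qed.

Lemma cobd_cobd (V : Type) (phi : seq V -> A) s : cobd (cobd phi) s = 0.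
Proof.
elim: s phi => //= x s IH phi.
by rewrite (cobd_sub phi (cobd (fun t => phi (x :: t)))) IH; ring.
Qed.

Lemma cobd_map (V W : Type) (f : V -> W) (phi : seq W -> A) s :
  cobd (fun t => phi (map f t)) s = cobd phi (map f s).
Proof.
by elim: s phi => //= x s IH phi; rewrite (IH (fun t => phi (f x :: t))).
Qed.

Definition alternating_on (V : eqType) (n : nat) (Q : {pred V}) (phi : seq V -> A) :=
  forall u x y w, size (u ++ x :: y :: w) = n -> all [in Q] (u ++ x :: y :: w) ->
    phi (u ++ x :: y :: w) = - phi (u ++ y :: x :: w).

(** Faces omitting neither [x] nor [y] change sign by hypothesis; the two faces omitting one of them
    are exchanged and occur with opposite signs. *)
Lemma alternating_cobd (V : eqType) n (Q : {pred V}) (phi : seq V -> A) :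
  alternating_on n Q phi -> alternating_on n.+1 Q (cobd phi).
Proof.
move=> alt u; elim: u n phi alt => /= [|z u IH] n phi alt x y w.
  move=> [] sw /and3P[xQ yQ wQ].
  have -> : cobd (fun t => phi [:: x, y & t]) w
          = cobd (fun t => - phi [:: y, x & t]) w.
    apply: eq_cobd => t st tw; apply: (alt [::]) => /=; first by rewrite st sw.
    rewrite xQ yQ /=; apply/allP => v /tw; exact: (allP wQ).
  by rewrite cobd_opp; ring.
move=> [] su /andP[zQ uQ].
rewrite (alt u x y w su uQ).
case: n => [|n] in alt su *.
  by move: su; rewrite size_cat /= addnS.
rewrite (IH n (fun t => phi (z :: t))) //; first by ring.
by move=> u' x' y' w' su' aQ; apply: (alt (z :: u')) => /=; rewrite ?su' ?zQ.
Qed.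

Lemma alternating_repeat (V : eqType) n (Q : {pred V}) (phi : seq V -> A) s :
  (forall a : A, a = - a -> a = 0) ->
  alternating_on n Q phi -> size s = n -> all [in Q] s -> ~~ uniq s -> phi s = 0.
Proof.
move=> two alt.
have rep w : forall u x t, size (u ++ x :: w ++ x :: t) = n ->
  all [in Q] (u ++ x :: w ++ x :: t) -> phi (u ++ x :: w ++ x :: t) = 0.
  elim: w => /= [|y w IH] u x t sz aQ.
    by apply: two; exact: alt.
  rewrite alt // -(cat1s y) catA IH ?oppr0 //.
    by rewrite -sz !size_cat /= size_cat /=; lia.
  by move: aQ; rewrite !all_cat /= all_cat /= => /and5P[-> -> -> -> ->].
move=> sz sQ nu.
suff [u [x [w [t e]]]] : exists u x w t, s = u ++ x :: w ++ x :: t.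
  by move: sz sQ; rewrite e; apply: rep.
elim: s {sz sQ} nu => //= x s IH; case: (boolP (x \in s)) => /= [/splitPr[p1 p2] _|_ /IH].
  by exists [::], x, p1, p2.
by move=> [u [y [w [t ->]]]]; exists (x :: u), y, w, t.
Qed.

End Cochains.

(** * Exactness of the periodic resolution and the lifted cocycle *)

Section Resolution.
Variable q : nat.

Definition shift_weight (k : nat) (c : 'F_q) : 'F_q :=
  if odd k then 1 else (c == 1)%:R - (c == 0)%:R.

(* The two alternating maps of the periodic resolution of Z/q: [g - 1] for
   even [k], the norm [1 + g + ... + g^(q-1)] for odd [k]. *)
Definition resol (V : Type) (act : 'F_q -> V -> V) (k : nat)
    (phi : seq V -> 'F_q) (s : seq V) : 'F_q :=
  \sum_c shift_weight k c * phi (map (act c) s).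

Lemma resol_even (V : Type) (act : 'F_q -> V -> V) k phi s : ~~ odd k ->
  resol act k phi s = phi (map (act 1) s) - phi (map (act 0) s).
Proof.
move=> /negPf ek; rewrite /resol /shift_weight ek.
under eq_bigr do rewrite mulrBl; rewrite sumrB; congr (_ - _).
  by rewrite (bigD1 1) //= ?eqxx ?mul1r big1 ?addr0 // => i /negPf ->; rewrite mul0r.
by rewrite (bigD1 0) //= ?eqxx ?mul1r big1 ?addr0 // => i /negPf ->; rewrite mul0r.
Qed.

Lemma resol_odd (V : Type) (act : 'F_q -> V -> V) k phi s : odd k ->
  resol act k phi s = \sum_c phi (map (act c) s).
Proof.
by move=> ok; apply: eq_bigr => c _; rewrite /shift_weight ok mul1r.
Qed.

Lemma sum_shift_weight k : ~~ odd k -> \sum_c shift_weight k c = 0.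
Proof.
move=> ek.
have := @resol_even unit (fun=> id) k (fun=> 1) [::] ek.
by rewrite subrr /resol; under eq_bigr do rewrite mulr1.
Qed.

(** Composition convolves the weights; one of them is constant, so each coefficient is the sum of
    the other, which is 0. *)
Lemma resol_resol (V : Type) (act : 'F_q -> V -> V) k l phi s :
  (forall a b x, act a (act b x) = act (a + b) x) -> odd k != odd l ->
  resol act k (resol act l phi) s = 0.
Proof.
move=> actA kl; rewrite /resol.
transitivity (\sum_e (\sum_c shift_weight k c * shift_weight l (e - c))
                * phi (map (act e) s)).
  under eq_bigr do rewrite mulr_sumr.
  under [RHS]eq_bigr do rewrite mulr_suml.
  rewrite [RHS]exchange_big /=; apply: eq_bigr => c _.
  rewrite (reindex_inj (addIr (- c))) /=; apply: eq_bigr => e _.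
  rewrite mulrA; congr (_ * phi _); rewrite -map_comp.
  by apply: eq_map => x /=; rewrite actA subrK.
apply: big1 => e _; case: (boolP (odd k)) kl => ok /=.
  move=> ol; rewrite (reindex_inj (subrI e)) /=.
  under eq_bigr do rewrite {1}/shift_weight ok mul1r (subKr e).
  by rewrite sum_shift_weight ?mul0r //; case: (odd l) ol.
move=> ol; have {}ol : odd l by case: (odd l) ol.
under eq_bigr do rewrite {2}/shift_weight ol mulr1.
by rewrite sum_shift_weight ?mul0r.
Qed.

Lemma resol_cobd (V : Type) (act : 'F_q -> V -> V) k phi s :
  resol act k (cobd phi) s = cobd (resol act k phi) s.
Proof.
rewrite /resol cobd_sum; apply: eq_bigr => c _; congr (_ * _).
by rewrite cobd_map.
Qed.

(** Partial sums step correctly even when [a + 1] wraps around to 0, because the full sum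
    vanishes. *)
Lemma sum_ltn_succ (F : 'F_q -> 'F_q) (a : 'F_q) : \sum_c F c = 0 ->
  \sum_(c : 'F_q | (c < (a + 1)%R)%N) F c = \sum_(c : 'F_q | (c < a)%N) F c + F a.
Proof.
move=> F0.
have -> : \sum_(c : 'F_q | (c < a)%N) F c + F a = \sum_(c : 'F_q | (c <= a)%N) F c.
  rewrite [RHS](bigD1 a) //= addrC; congr (_ + _); apply: eq_bigl => c.
  by rewrite ltn_neqAle andbC -val_eqE.
have va : ((a + 1)%R : nat) = (a.+1 %% (Zp_trunc (pdiv q)).+2)%N.
  by rewrite -[a.+1]addn1 /= ?modnDmr.
have [lt|ge] := ltnP a.+1 (Zp_trunc (pdiv q)).+2.
  by apply: eq_bigl => c; rewrite va modn_small.
have ae : a.+1 = (Zp_trunc (pdiv q)).+2 by apply/eqP; rewrite eqn_leq ge (ltn_ord a).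
rewrite [LHS]big1 => [|c]; last by rewrite va ae modnn.
rewrite -[LHS]F0; apply: eq_bigl => c; symmetry.
by rewrite -ltnS ae ltn_ord.
Qed.

Variable N : nat.
Notation label := ('F_q * 'I_N)%type.

Definition shift_label (c : 'F_q) (x : label) : label := (x.1 + c, x.2).

Lemma shift_labelD a b x :
  shift_label a (shift_label b x) = shift_label (a + b) x.
Proof. by rewrite /shift_label /= -addrA [b + a]addrC. Qed.

Lemma shift_label0 x : shift_label 0 x = x.
Proof. by case: x => a l; rewrite /shift_label addr0. Qed.

(* A vertex of smallest index; unique when no two labels of [x :: s] share
   their index. *)
Definition lead (x : label) (s : seq label) : label :=
  foldr (fun y z : label => if (y.2 <= z.2)%N then y else z) x s.

Lemma lead_shift c x s :
  lead (shift_label c x) (map (shift_label c) s) = shift_label c (lead x s).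
Proof. by elim: s => //= y s ->; case: ifP. Qed.

Lemma lead_min x s :
  lead x s \in x :: s /\ forall y, y \in x :: s -> ((lead x s).2 <= y.2)%N.
Proof.
elim: s => /= [|z s [IH1 IH2]].
  by split; rewrite ?mem_seq1 // => y; rewrite mem_seq1 => /eqP ->.
case: ifP => zl; split.
- by rewrite !inE eqxx orbT.
- move=> y; rewrite !inE => /or3P[yx|/eqP->//|ys]; apply: (leq_trans zl); apply: IH2.
    by rewrite inE yx.
  by rewrite inE ys orbT.
- by move: IH1; rewrite !inE => /orP[->|->]; rewrite ?orbT.
move=> y; rewrite !inE => /or3P[yx|/eqP->|ys].
- by apply: IH2; rewrite inE yx.
- by apply: ltnW; rewrite ltnNge zl.
- by apply: IH2; rewrite inE ys orbT.
Qed.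

Definition lead_pos (s : seq label) : 'F_q :=
  if s is x :: s' then (lead x s').1 else 0.

Definition section (Q : {pred label}) :=
  {in Q &, forall x y : label, x.2 = y.2 -> x = y}.

Lemma lead_pos_shift c s : (0 < size s)%N ->
  lead_pos (map (shift_label c) s) = lead_pos s + c.
Proof. by case: s => //= x s _; rewrite lead_shift. Qed.

Lemma lead_pos_perm (Q : {pred label}) s t : section Q -> all [in Q] s ->
  perm_eq s t -> lead_pos s = lead_pos t.
Proof.
case: s => [|x s]; case: t => [|y t] //; try by move=> _ _ /perm_size.
move=> secQ sQ st /=.
have [l1 m1] := lead_min x s; have [l2 m2] := lead_min y t.
have l12 : lead x s \in y :: t by rewrite -(perm_mem st).
have l21 : lead y t \in x :: s by rewrite (perm_mem st).
congr (fst _); apply: secQ; try exact: (allP sQ).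
by apply/val_inj/eqP; rewrite eqn_leq m1 // m2.
Qed.

(** A preimage of [xi] under [resol k], with [lead_pos s = 0] as fundamental domain of the free
    action: cutting off to it inverts the norm, summing along the orbit from it up to [s] inverts
    [g - 1]. *)
Definition resol_lift (k : nat) (xi : seq label -> 'F_q) (s : seq label) : 'F_q :=
  if odd k then (lead_pos s == 0)%:R * xi s
  else \sum_(c : 'F_q | (c < lead_pos s)%N) xi (map (shift_label (c - lead_pos s)) s).

(** Exactness. For odd [k] the hypothesis makes [xi] invariant, so the translates of its cut-off add
    up to it. For even [k] orbit sums vanish, so the partial sums close up around the orbit and have
    increments [xi]. *)
Lemma resol_liftK k xi s : (0 < size s)%N ->
  (forall t, size t = size s -> resol shift_label k.+1 xi t = 0) ->
  resol shift_label k (resol_lift k xi) s = xi s.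
Proof.
move=> s0 xi0; case: (boolP (odd k)) => ok.
  have inv (n : nat) : xi (map (shift_label n%:R) s) = xi s.
    elim: n => [|n IH]; first by congr xi; apply: map_id_in => x _; rewrite shift_label0.
    rewrite -IH; have := xi0 (map (shift_label n%:R) s) (size_map _ _).
    rewrite resol_even /= ?ok // => /eqP; rewrite subr_eq0 => /eqP.
    rewrite -!map_comp => e.
    rewrite (eq_map (g := shift_label 1 \o shift_label n%:R)); last first.
      by move=> x /=; rewrite shift_labelD -natr1 addrC.
    rewrite e; congr xi; apply: eq_map => x /=.
    by rewrite shift_labelD add0r.
  rewrite resol_odd //.
  transitivity (\sum_(c : 'F_q) (lead_pos s + c == 0)%:R * xi s).
    apply: eq_bigr => c _; rewrite /resol_lift ok lead_pos_shift //.
    by rewrite -[X in shift_label X](natr_Zp c) inv.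
  rewrite -mulr_suml (bigD1 (- lead_pos s)) //= subrr eqxx big1 ?addr0 ?mul1r // => c.
  by rewrite addrC addr_eq0 => /negPf ->.
rewrite resol_even // /resol_lift (negPf ok) !lead_pos_shift // addr0.
set a := lead_pos s; pose F c := xi (map (shift_label (c - a)) s).
have F0 : \sum_c F c = 0.
  rewrite -[RHS](xi0 s) // resol_odd /= ?ok // (reindex_inj (addIr a)) /=.
  by apply: eq_bigr => c _; rewrite /F addrK.
have -> : xi s = F a by rewrite /F subrr map_id_in // => x _; rewrite shift_label0.
apply/eqP; rewrite subr_eq; apply/eqP; rewrite [RHS]addrC.
transitivity (\sum_(c : 'F_q | (c < (a + 1)%R)%N) F c).
  apply: eq_bigr => c _; rewrite /F -map_comp; congr xi; apply: eq_map => x /=.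
  by rewrite shift_labelD opprD addrA subrK.
rewrite sum_ltn_succ //; congr (_ + _); apply: eq_bigr => c _.
rewrite /F -map_comp; congr xi; apply: eq_map => x /=.
by rewrite shift_labelD addr0.
Qed.

(** The base is the augmentation, 1 on each vertex. Each further step is a connecting map: divide by
    [resol], then take the coboundary. *)
Fixpoint label_cocycle (k : nat) : seq label -> 'F_q :=
  if k is k'.+1 then cobd (resol_lift k' (label_cocycle k')) else cobd (fun=> 1).

(** The map [resol k.+2] kills [label_cocycle k.+1]: it commutes with [cobd] and agrees with
    [resol k], so it gives [cobd (label_cocycle k)], a double coboundary. *)
Lemma resol_label_cocycle k s : size s = k.+1 ->
  resol shift_label k (resol_lift k (label_cocycle k)) s = label_cocycle k s.
Proof.
elim: k s => [|k IH] s sz; apply: resol_liftK; rewrite ?sz //.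
  (* In degree 0 the norm of the constant 1 is the order of the group, which is 0 in ['F_q]. *)
  case=> [//|x [|//]] _; rewrite resol_odd //=.
  rewrite subr0 sumr_const card_ord; apply/val_inj.
  by rewrite Zp_nat /= modnn.
move=> t st; rewrite /= resol_cobd.
transitivity (cobd (label_cocycle k) t).
  apply: eq_cobd => u su _; rewrite -IH; last by rewrite -su in st; case: st.
  by rewrite /resol /shift_weight /= negbK.
case: k {IH sz st} => [|k]; exact: cobd_cobd.
Qed.

(** [lead_pos] ignores the order of the vertices of a section, so the lift inherits alternation. Its
    translates lie in a translated section, hence the induction over all [Q]. *)
Lemma alternating_label_cocycle k (Q : {pred label}) : section Q ->
  alternating_on k.+1 Q (label_cocycle k).
Proof.
elim: k Q => [|k IH] Q secQ.
  by case=> [|z u] x y w //=; rewrite size_cat /= addnS.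
apply: alternating_cobd => u x y w sz aQ.
have pe : perm_eq (u ++ x :: y :: w) (u ++ y :: x :: w).
  by rewrite perm_cat2l; apply/permP => p /=; rewrite addnCA.
have pos : lead_pos (u ++ x :: y :: w) = lead_pos (u ++ y :: x :: w).
  exact: (lead_pos_perm secQ aQ pe).
rewrite /resol_lift pos; case: ifP => _.
  by rewrite -mulrN; congr (_ * _); exact: (IH Q secQ u x y w sz aQ).
rewrite -sumrN; apply: eq_bigr => c _; rewrite !map_cat /=.
set c' := _ - _.
apply: (IH [pred z | shift_label (- c') z \in Q]).
- move=> z1 z2 z1Q z2Q e; have /= := secQ _ _ z1Q z2Q e.
  by move=> /(congr1 (shift_label c')); rewrite !shift_labelD subrr !shift_label0.
- by rewrite -sz !size_cat /= !size_map.
move: aQ; rewrite !all_cat /= !all_map => /and4P[uQ xQ yQ wQ].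
have sk z : z \in Q -> shift_label (- c') (shift_label c' z) \in Q.
  by rewrite shift_labelD addNr shift_label0.
rewrite !inE !sk //=; apply/andP; split.
  by apply/allP => z zu /=; rewrite inE sk // (allP uQ).
by apply/allP => z zu /=; rewrite inE sk // (allP wQ).
Qed.

End Resolution.

(** * Subdivision and the join *)

Section Subdivision.
Variables (R : realType) (V : normedModType R) (A : comNzRingType).
Implicit Types (phi psi : seq V -> A) (s t : seq V) (C : V -> Prop).

Definition bary s : V := (size s)%:R^-1 *: \sum_(x <- s) x.

(* The transpose, acting on cochains, of barycentric subdivision of affine
   simplices with [n] vertices. *)
Fixpoint sd (n : nat) phi s : A :=
  if n is n'.+1 then cobd (sd n' (fun t => phi (bary s :: t))) s else phi s.

Lemma sd_sum n (I : finType) (w : I -> A) (phi : I -> seq V -> A) s :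
  sd n (fun t => \sum_i w i * phi i t) s = \sum_i w i * sd n (phi i) s.
Proof.
elim: n phi s => //= n IH phi s; rewrite -cobd_sum.
by congr cobd; apply/funext => t; rewrite IH.
Qed.

Lemma sd_sub n phi psi s :
  sd n (fun t => phi t - psi t) s = sd n phi s - sd n psi s.
Proof.
elim: n phi psi s => //= n IH phi psi s; rewrite -cobd_sub.
by congr cobd; apply/funext => t; rewrite IH.
Qed.

(** Replaces convexity: subdivision only forms barycentres of vertex lists. *)
Definition avg_closed C := forall s, s != [::] ->
  (forall x, x \in s -> C x) -> C (bary s).

Definition diam_le (D : R) s := {in s &, forall x y, `|x - y| <= D}.

Lemma bary_sub x s : s != [::] ->
  bary s - x = (size s)%:R^-1 *: \sum_(y <- s) (y - x).
Proof.
move=> s0; have z0 : (size s)%:R != 0 :> R by rewrite pnatr_eq0 size_eq0.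
rewrite sumrB big_const_seq count_predT iter_addr_0 scalerBr -[x *+ _]scaler_nat scalerA.
by rewrite mulVf // scale1r.
Qed.

Lemma avg_closed_ball (x : V) (r : R) : avg_closed (fun y => `|y - x| <= r).
Proof.
move=> s s0 sr; have z0 : 0 < (size s)%:R :> R by rewrite ltr0n lt0n size_eq0.
rewrite bary_sub // normrZ ger0_norm ?invr_ge0 ?(ltW z0) // mulrC ler_pdivrMr //.
apply: (le_trans (ler_norm_sum _ _ _)).
rewrite mulr_natr -[X in _ *+ X](count_predT s) -iter_addr_0 -big_const_seq.
rewrite !big_seq; apply: ler_sum => y ys; exact: sr.
Qed.

Lemma bary_dist K D x s : (size s <= K.+1)%N -> x \in s -> diam_le D s ->
  `|bary s - x| <= K%:R / K.+1%:R * D.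
Proof.
move=> sK xs sD; have s0 : s != [::] by case: (s) xs.
have z0 : 0 < (size s)%:R :> R by rewrite ltr0n lt0n size_eq0.
have D0 : 0 <= D by apply: le_trans (sD x x xs xs).
rewrite bary_sub // normrZ ger0_norm ?invr_ge0 ?(ltW z0) //.
have le1 : `|\sum_(y <- s) (y - x)| <= (size s).-1%:R * D.
  rewrite (big_rem x xs) /= subrr add0r.
  apply: (le_trans (ler_norm_sum _ _ _)).
  rewrite mulr_natl -(size_rem xs) -[X in _ *+ X](count_predT (rem x s)).
  rewrite -iter_addr_0 -big_const_seq !big_seq; apply: ler_sum => y /mem_rem ys.
  exact: sD.
apply: (le_trans (ler_wpM2l _ le1)); first by rewrite invr_ge0 ltW.
rewrite mulrA ler_wpM2r // mulrC ler_pdivrMr // mulrAC ler_pdivlMr ?ltr0n //.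
by rewrite -!natrM ler_nat; move: sK; case: (size s) => /= [//|n]; nia.
Qed.

Definition refines (K : nat) s t := [/\ size t = size s,
  forall C, avg_closed C -> (forall x, x \in s -> C x) -> forall x, x \in t -> C x
  & forall D, diam_le D s -> diam_le (K%:R / K.+1%:R * D) t].

(** Locality stands in for a list of the simplices of the subdivision: [sd] reads its cochain on
    refining simplices only. *)
Lemma eq_sd K n phi psi s : size s = n -> (n <= K.+1)%N ->
  (forall t, refines K s t -> phi t = psi t) -> sd n phi s = sd n psi s.
Proof.
elim: n phi psi s => [|n IH] phi psi s sz nK e /=.
  by apply: e; case: s sz => // _; split.
apply: eq_cobd => t st ts.
have sn : size t = n by move: st; rewrite sz => -[].
apply: IH => //; first exact: ltnW.
move=> u [us uC uD]; apply: e.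
have s0 : s != [::] by case: (s) sz.
split=> [|C Cc sC x|D sD].
- by rewrite /= us st.
- rewrite inE => /orP[/eqP ->|xu]; first exact: Cc.
  by apply: (uC C) xu => // y /ts; exact: sC.
have tD : diam_le D t by move=> x y /ts xs /ts; exact: sD.
have near y : y \in u -> `|y - bary s| <= K%:R / K.+1%:R * D.
  apply: (uC _ (@avg_closed_ball _ _)) => z /ts zs; rewrite distrC.
  by apply: bary_dist => //; rewrite sz.
have D0 : 0 <= D.
  by case: (s) s0 sD => // a l _ /(_ a a (mem_head _ _) (mem_head _ _)); apply: le_trans.
move=> x y; rewrite !inE => /orP[/eqP->|xu] /orP[/eqP->|yu].
- by rewrite subrr normr0 mulr_ge0 // divr_ge0.
- by rewrite distrC near.
- exact: near.
exact: uD.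
Qed.

Lemma eq_sd_size n phi psi s : size s = n ->
  (forall t, size t = n -> phi t = psi t) -> sd n phi s = sd n psi s.
Proof.
by move=> sz e; apply: (@eq_sd n) => // t [st _ _]; apply: e; rewrite st.
Qed.

(** Dual to the boundary of a cone, [d(b * c) = c - b * dc]. By induction the second part becomes a
    double coboundary and vanishes. *)
Lemma sd_cobd n phi s : size s = n.+1 ->
  sd n.+1 (cobd phi) s = cobd (sd n phi) s.
Proof.
elim: n phi s => [|n IH] phi s sz.
  by case: s sz => [|x [|]] //= _; rewrite subr0.
set b := bary s.
transitivity (cobd (fun t => sd n.+1 phi t -
                     cobd (sd n (fun u => phi (b :: u))) t) s).
  apply: eq_cobd => t; rewrite sz => -[st] _; rewrite -IH //.
  by rewrite -(sd_sub n.+1 phi).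
by rewrite (cobd_sub (sd n.+1 phi)) cobd_cobd subr0.
Qed.

Lemma sd_map (f : {linear V -> V}) n phi s :
  sd n (fun t => phi (map f t)) s = sd n phi (map f s).
Proof.
elim: n phi s => //= n IH phi s; rewrite -cobd_map.
congr cobd; apply/funext => t; rewrite -IH; congr (sd n _ t).
apply/funext => u /=; congr (phi (_ :: _)).
by rewrite /bary size_map linearZ linear_sum big_map.
Qed.

Lemma iter_sd_map (f : {linear V -> V}) m n phi s :
  iter m (sd n) (fun t => phi (map f t)) s = iter m (sd n) phi (map f s).
Proof.
elim: m s => //= m IH s; rewrite -sd_map.
by congr (sd n _ s); apply/funext => t; rewrite IH.
Qed.

Lemma iter_sd_sum m n (I : finType) (w : I -> A) (phi : I -> seq V -> A) s :
  iter m (sd n) (fun t => \sum_i w i * phi i t) s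
  = \sum_i w i * iter m (sd n) (phi i) s.
Proof.
elim: m s => //= m IH s; rewrite -sd_sum.
by congr (sd n _ s); apply/funext => t; rewrite IH.
Qed.

Lemma iter_sd_cobd m n phi s : size s = n.+1 ->
  iter m (sd n.+1) (cobd phi) s = cobd (iter m (sd n) phi) s.
Proof.
elim: m s => // m IH s sz; rewrite !iterS -sd_cobd //.
by apply: eq_sd_size => // t; apply: IH.
Qed.

Lemma eq_iter_sd K m n (E : V -> Prop) D phi psi s :
  size s = n -> (n <= K.+1)%N -> avg_closed E ->
  (forall x, x \in s -> E x) -> diam_le D s ->
  (forall t, size t = n -> (forall x, x \in t -> E x) ->
     diam_le ((K%:R / K.+1%:R) ^+ m * D) t -> phi t = psi t) ->
  iter m (sd n) phi s = iter m (sd n) psi s.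
Proof.
move=> + nK Ec; elim: m D s => [|m IH] D s sz sE sD e /=.
  by apply: e => //; rewrite expr0 mul1r.
apply: (@eq_sd K) => // t [ts tC tD].
apply: (IH (K%:R / K.+1%:R * D)) => //; first by rewrite ts.
- by apply: (tC E).
- exact: tD.
by move=> u su uE uD; apply: e => //; rewrite exprSr -mulrA.
Qed.

End Subdivision.

(** * The fundamental chain of the join *)

Section JoinChain.
Variables (q : nat) (R : realType) (V : normedModType R).
Variable act : 'F_q -> {linear V -> V}.
Hypothesis actD : forall a b x, act a (act b x) = act (a + b) x.
Hypothesis act0 : forall x, act 0 x = x.
Variable v : nat -> V.
Implicit Types phi psi : seq V -> 'F_q.

(* Evaluation of cochains on the chain [c k] of the join of the orbits of
   [v 0, ..., v k] given by [c 0 = v 0] and [c k.+1 = v k.+1 * (theta k (c k))],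
   where [theta k] is [resol act k]; [c k.+1] has boundary [theta k (c k)]. *)
Fixpoint join_eval (k : nat) phi : 'F_q :=
  if k is k'.+1 then
    join_eval k' (resol act k' (fun t => phi (v k'.+1 :: t)))
  else phi [:: v 0%N].

Lemma join_eval_sub k phi psi :
  join_eval k (fun t => phi t - psi t) = join_eval k phi - join_eval k psi.
Proof.
elim: k phi psi => //= k IH phi psi; rewrite -IH; congr join_eval.
by apply/funext => t; rewrite /resol -sumrB; apply: eq_bigr => c _; rewrite mulrBr.
Qed.

Lemma eq_join_eval k phi psi :
  (forall t, size t = k.+1 ->
     (exists a : nat -> 'F_q, forall x, x \in t ->
        exists2 i, (i <= k)%N & x = act (a i) (v i)) -> phi t = psi t) ->
  join_eval k phi = join_eval k psi.
Proof.
elim: k phi psi => [|k IH] phi psi e /=.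
  apply: e => //; exists (fun=> 0) => x; rewrite mem_seq1 => /eqP ->.
  by exists 0%N; rewrite ?act0.
apply: IH => t st [a ta]; apply: eq_bigr => c _; congr (_ * _); apply: e.
  by rewrite /= size_map st.
exists (fun i => if (i <= k)%N then c + a i else 0) => x.
rewrite inE => /orP[/eqP ->|/mapP[y /ta[i ik ->] ->]].
  by exists k.+1; rewrite // ltnn act0.
by exists i; rewrite ?ik 1?ltnW // actD.
Qed.

(** Besides the base [theta k (c k)], the cone formula leaves a cone over its boundary. That
    boundary is a composite of consecutive maps of the resolution, hence 0; for [k = 0] it is the
    augmentation of a difference of two vertices. *)
Lemma join_eval_cobd k phi :
  join_eval k.+1 (cobd phi) = join_eval k (resol act k phi).
Proof.
have split_cone l psi : join_eval l.+1 (cobd psi) = join_eval l (resol act l psi)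
    - join_eval l (cobd (resol act l (fun t => psi (v l.+1 :: t)))).
  rewrite -join_eval_sub /=; congr join_eval; apply/funext => t.
  rewrite -resol_cobd /resol -sumrB; apply: eq_bigr => c _.
  by rewrite /= mulrBr.
rewrite split_cone; apply/eqP; rewrite subr_eq addrC -subr_eq subrr eq_sym; apply/eqP.
have res0 l t (psi : seq V -> 'F_q) : resol act l (resol act l.+1 psi) t = 0.
  by apply: resol_resol => //=; case: (odd l).
elim: k phi => [|k IH] phi.
  by rewrite /= resol_even //= subrr subr0.
rewrite split_cone.
have -> : resol act k (resol act k.+1 (fun t => phi (v k.+2 :: t))) = fun=> 0.
  by apply/funext => t; rewrite res0.
have -> : join_eval k (fun=> 0) = 0.
  transitivity (join_eval k (fun=> 0 - 0)); last by rewrite join_eval_sub subrr.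
  by congr join_eval; apply/funext => t; rewrite subrr.
by rewrite IH subr0.
Qed.

(** Pair the label cocycles, pulled back by [lab], with a fine subdivision of the chains of the
    join. All pairings are 1 by Stokes and [resol_label_cocycle], but in degree [N] the pairing is
    0, since [N + 1] vertices have only [N] indices available. *)
Lemma no_equivariant_labelling N (E : V -> Prop) (lab : V -> 'F_q * 'I_N) (D e : R) :
  (forall a : 'F_q, a = - a -> a = 0) -> 0 < e ->
  (forall i j a b, `|act a (v i) - act b (v j)| <= D) ->
  (forall a : nat -> 'F_q, exists C : V -> Prop, [/\ avg_closed C,
     forall x, C x -> E x & forall i, (i <= N)%N -> C (act (a i) (v i))]) ->
  (forall c x, E x -> lab (act c x) = shift_label c (lab x)) ->
  (forall x y, E x -> E y -> `|x - y| < e -> (lab x).2 = (lab y).2 -> lab x = lab y) ->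
  False.
Proof.
move=> two e0 vD faces lab_act lab_near.
have [m mD] : exists m, (N%:R / N.+1%:R) ^+ m * D < e.
  have r1 : `|N%:R / N.+1%:R : R| < 1.
    by rewrite ger0_norm ?divr_ge0 // ltr_pdivrMr ?ltr0n // mul1r ltr_nat.
  have D0 : 0 <= D by apply: le_trans (vD 0%N 0%N 0 0).
  have := cvg_expr r1 => /cvgrPdist_lt /(_ (e / (D + 1))).
  have D1 : 0 < D + 1 by lra.
  case; first by rewrite divr_gt0.
  move=> m _ /(_ m (leqnn m)); rewrite sub0r normrN ltr_pdivlMr // => lt_e.
  exists m; apply: le_lt_trans lt_e.
  apply: (le_trans (ler_norm _)); rewrite normrM ler_wpM2l //.
  by rewrite ger0_norm // lerDl.
pose ev k phi := join_eval k (iter m (sd k.+1) phi).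
have eq_ev k phi psi : (k <= N)%N ->
  (forall t, size t = k.+1 -> (forall x, x \in t -> E x) ->
     diam_le ((N%:R / N.+1%:R) ^+ m * D) t -> phi t = psi t) ->
  ev k phi = ev k psi.
  move=> kN eqt; apply: eq_join_eval => t st [a ta].
  have [C [Cc CE Ca]] := faces a.
  apply: (@eq_iter_sd _ _ _ N m k.+1 C D) => //.
  - by move=> x /ta[i ik ->]; apply: Ca; apply: leq_trans kN.
  - by move=> x y /ta[i _ ->] /ta[j _ ->].
  by move=> u su uC uD; apply: eqt => // x /uC; apply: CE.
pose xi k t := @label_cocycle q N k (map lab t).
have ev_xi k : (k <= N)%N -> ev k (xi k) = 1.
  elim: k => [|k IH] kN.
    have -> : xi 0%N = cobd (fun=> 1).
      by apply/funext => t; rewrite /xi /= -cobd_map.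
    transitivity (iter m (sd 1) (cobd (fun=> 1 : 'F_q)) [:: v 0%N]) => //.
    rewrite iter_sd_cobd //= subr0.
    by elim: (m) => //= n ->.
  rewrite -(IH (ltnW kN)).
  (* Stokes: [xi k.+1] is the coboundary of [tau], and the boundary of [c k.+1] is [theta k (c k)];
     by equivariance of [lab], [theta k] turns [tau] into [xi k]. *)
  pose tau t := resol_lift k (@label_cocycle q N k) (map lab t).
  have -> : xi k.+1 = cobd tau by apply/funext => t; rewrite /xi /= -cobd_map.
  transitivity (join_eval k.+1 (cobd (iter m (sd k.+1) tau))).
    by apply: eq_join_eval => t st _; rewrite iter_sd_cobd.
  rewrite join_eval_cobd.
  transitivity (ev k (resol act k tau)).
    congr join_eval; apply/funext => t; rewrite /resol iter_sd_sum.
    by apply: eq_bigr => c _; rewrite iter_sd_map.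
  apply: eq_ev; first exact: ltnW.
  move=> t st tE _; rewrite /xi -resol_label_cocycle ?size_map //.
  apply: eq_bigr => c _; congr (_ * resol_lift _ _ _).
  by rewrite -!map_comp; apply/eq_in_map => x /tE Ex /=; apply: lab_act.
(* The difference is the zero cochain; written as an empty sum, it is seen to be preserved by
   subdivision. *)
have := ev_xi N (leqnn N); rewrite (@eq_ev N _ (fun t => xi N t - xi N t)) //.
  have -> : (fun t => xi N t - xi N t) = (fun t => \sum_(i : 'I_0) 0 * xi N t).
    by apply/funext => t; rewrite subrr big_ord0.
  rewrite /ev.
  have -> : iter m (sd N.+1) (fun t => \sum_(i : 'I_0) 0 * xi N t)
            = (fun t => xi N t - xi N t).
    by apply/funext => t; rewrite (iter_sd_sum _ _ (fun=> 0)) big_ord0 subrr.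
  by rewrite join_eval_sub subrr => /eqP; rewrite eq_sym oner_eq0.
move=> t st tE tD; rewrite subrr.
(* On a small simplex equal indices force equal labels, so the labels form a section; [N + 1] of
   them cannot be distinct. *)
apply: (@alternating_repeat _ _ N.+1 [in map lab t]); rewrite ?size_map //.
- apply: alternating_label_cocycle => _ _ /mapP[x xt ->] /mapP[y yt ->].
  apply: lab_near; [exact: tE|exact: tE|].
  by apply: le_lt_trans mD; apply: tD.
apply/negP => ut.
have inj : {in map lab t &, injective snd}.
  move=> _ _ /mapP[x xt ->] /mapP[y yt ->].
  apply: lab_near; [exact: tE|exact: tE|].
  by apply: le_lt_trans mD; apply: tD.
have /card_uniqP cu : uniq (map snd (map lab t)) by rewrite map_inj_in_uniq.
have := max_card (mem (map snd (map lab t))).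
by rewrite cu !size_map st card_ord ltnn.
Qed.

End JoinChain.

(** * A Borsuk-Ulam theorem for Z/q *)

Section Compactness.
Local Open Scope classical_set_scope.
Variables (R : realType) (V : normedModType R).

Lemma compact_uniform_radius (K : set V) (P : R -> V -> Prop) : compact K ->
  (forall x, K x -> exists2 r, 0 < r &
     forall x' e, `|x - x'| < r -> 0 < e -> e < r -> P e x') ->
  exists2 e, 0 < e & forall x, K x -> P e x.
Proof.
move=> /compact_near_coveringP cK loc.
have [|r /= r0 rP] := cK _ (0^'+ : set_system R) P _.
  move=> x /loc[r r0 rP].
  exists (ball x r, [set e | 0 < e < r]); last first.
    by move=> [x' e] /= [+ /andP[e0 er]]; rewrite -ball_normE => xx'; exact: rP.
  split=> /=; first exact: nbhsx_ballx.
  exists r => //= e; rewrite /ball_ /= sub0r normrN => + e0.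
  by rewrite gtr0_norm // e0.
exists (r / 2); first by rewrite divr_gt0.
apply: rP => /=; last by rewrite divr_gt0.
by rewrite sub0r normrN gtr0_norm ?divr_gt0 //; lra.
Qed.

Lemma continuous_finite_family (I : finType) (F : I -> V -> R) x e :
  (forall i, continuous (F i)) -> 0 < e ->
  exists2 r, 0 < r & forall i y, `|x - y| < r -> `|F i x - F i y| < e.
Proof.
move=> cF e0.
have : \forall y \near x, forall i, `|F i x - F i y| < e.
  apply: filter_forall => i.
  by have /cvgrPdist_lt /(_ e e0) := cF i x.
move=> /nbhs_ballP[r r0 rP]; exists r => // i y xy; apply: rP.
by rewrite -ball_normE.
Qed.

Lemma compact_unif_continuous (K : set V) (I : finType) (F : I -> V -> R) e :
  compact K -> (forall i, continuous (F i)) -> 0 < e ->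
  exists2 r, 0 < r & forall x y i, K x -> `|x - y| < r -> `|F i x - F i y| < e.
Proof.
move=> cK cF e0.
suff loc x : K x -> exists2 r, 0 < r & forall x' s, `|x - x'| < r -> 0 < s -> s < r ->
    forall y i, `|x' - y| < s -> `|F i x' - F i y| < e.
  have [r r0 rP] := compact_uniform_radius cK loc.
  by exists r => // x y i Kx; apply: rP.
move=> _; have e2 : 0 < e / 2 by rewrite divr_gt0.
have [r r0 rP] := continuous_finite_family x cF e2.
exists (r / 2); first by rewrite divr_gt0.
move=> x' s xx' s0 sr y i x'y.
have h1 : `|F i x - F i x'| < e / 2 by apply: rP; lra.
have h2 : `|F i x - F i y| < e / 2.
  apply: rP; have := ler_distD x' x y; lra.
have := ler_distD (F i x) (F i x') (F i y); rewrite [`|F i x' - F i x|]distrC; lra.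
Qed.

Lemma compact_positive_gap (K : set V) (I : finType) (F : I -> V -> R) :
  compact K -> (forall i, continuous (F i)) ->
  (forall x, K x -> exists i, 0 < F i x) ->
  exists2 r, 0 < r & forall x, K x -> exists i, r <= F i x.
Proof.
move=> cK cF pos; apply: compact_uniform_radius => // x /pos[i F0].
have [r r0 rP] := continuous_finite_family x cF (divr_gt0 F0 (ltr0n R 2)).
exists (Num.min r (F i x / 2)); first by rewrite lt_min r0 divr_gt0.
move=> x' e; rewrite !lt_min => /andP[xx' _] e0 /andP[_ eF]; exists i.
have := rP i x' xx'; rewrite ltr_norml; lra.
Qed.

End Compactness.

(* Pigeonhole: the #|T| slots of width [g / #|T|] above [a k] cannot all be hit
   by the values of [a] other than [a k]. *)
Lemma exists_gap_set (R : realType) (T : finType) (a : T -> R) (j k : T) (g : R) :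
  0 < g -> a k + g <= a j ->
  exists S : {set T}, [/\ j \in S, k \notin S &
    forall u w, u \in S -> w \notin S -> a w + g / #|T|%:R <= a u].
Proof.
move=> g0 kj; set h := g / _.
have T0 : (0 < #|T|)%N by apply/card_gt0P; exists k.
have h0 : 0 < h by rewrite divr_gt0 // ltr0n.
pose slot (r : 'I_#|T|) l := (a k + r%:R * h < a l) && (a l <= a k + r.+1%:R * h).
case: (pselect (exists r, forall l, ~~ slot r l)) => [[r empty]|hit]; last first.
  have {}hit r : exists l, slot r l.
    apply: contrapT => nl; apply: hit; exists r => l.
    by apply/negP => sl; apply: nl; exists l.
  have [f fP] := choice hit.
  have finj : injective f.
    suff lt r s : f r = f s -> (r < s)%N -> False.
      move=> r s e; apply/val_inj; case: (ltngtP r s) => // /lt; first by case/(_ e).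
      by case/(_ (esym e)).
    move=> e rs; have /andP[_] := fP r; have /andP[+ _] := fP s; rewrite e => l1 l2.
    have : (r.+1%:R : R) * h <= s%:R * h by rewrite ler_pM2r // ler_nat.
    lra.
  have := card_codom finj; rewrite card_ord => cf.
  have : (#|codom f| <= #|predC1 k|)%N.
    apply: subset_leq_card; apply/fintype.subsetP => _ /codomP[r ->]; rewrite !inE.
    apply/eqP => fk; have /andP[+ _] := fP r; rewrite fk.
    have : 0 <= r%:R * h by rewrite mulr_ge0 // ltW.
    lra.
  by rewrite cf cardC1; case: #|T| T0 => // n _; rewrite ltnn.
(* The empty slot [r] separates the values; [S] consists of those above it. *)
exists [set l | a k + r%:R * h < a l].
have rh0 : 0 <= r%:R * h by rewrite mulr_ge0 // ltW.
have rT : (r.+1%:R : R) * h <= g.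
  rewrite /h mulrA ler_pdivrMr ?ltr0n // mulrC ler_pM2l // ler_nat.
  exact: ltn_ord.
have rS : r.+1%:R * h = r%:R * h + h by rewrite -natr1 mulrDl mul1r.
split; rewrite ?inE.
- lra.
- by rewrite -leNgt; lra.
move=> u w; rewrite !inE -leNgt => ru wr.
have := empty u; rewrite /slot ru /= -ltNge; lra.
Qed.

(** * The join of N + 1 copies of Z/q *)

Section Join.
Variables (R : realType) (q N : nat).
Notation idx := ('I_N.+1 * 'F_q)%type.
Notation V := 'rV[R]_#|{: 'I_N.+1 * 'F_q}|.
Implicit Types (x y : V) (c : 'F_q).

Definition jcoord x (t : idx) : R := x ord0 (enum_rank t).

Definition jrow (f : idx -> R) : V := \row_k f (enum_val k).

Lemma jrowE f t : jcoord (jrow f) t = f t.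
Proof. by rewrite /jcoord mxE enum_rankK. Qed.

Lemma jcoord_inj x y : (forall t, jcoord x t = jcoord y t) -> x = y.
Proof.
by move=> e; apply/rowP => k; have := e (enum_val k); rewrite /jcoord enum_valK.
Qed.

Definition join_shift c x : V := jrow (fun t => jcoord x (t.1, t.2 - c)).

Lemma join_shift_linear c : linear (join_shift c).
Proof.
by move=> a x y; apply: jcoord_inj => t; rewrite jrowE /jcoord !mxE enum_rankK.
Qed.

HB.instance Definition _ c :=
  GRing.isLinear.Build R V V _ (join_shift c) (join_shift_linear c).

Lemma join_shiftE c x i b : jcoord (join_shift c x) (i, b) = jcoord x (i, b - c).
Proof. by rewrite jrowE. Qed.

Lemma join_shiftD a b x : join_shift a (join_shift b x) = join_shift (a + b) x.
Proof.
by apply: jcoord_inj => -[i e]; rewrite !join_shiftE opprD addrA.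
Qed.

Lemma join_shift0 x : join_shift 0 x = x.
Proof. by apply: jcoord_inj => -[i e]; rewrite !join_shiftE subr0. Qed.

(* The geometric join of [N + 1] copies of the discrete set Z/q. *)
Definition join : set V := [set x | [/\ forall t, 0 <= jcoord x t,
  \sum_t jcoord x t = 1 &
  forall i b b', b != b' -> jcoord x (i, b) * jcoord x (i, b') = 0]]%classic.

Lemma join_shift_join c x : join x -> join (join_shift c x).
Proof.
move=> [x0 x1 x2]; split.
- by case=> i b; rewrite join_shiftE.
- rewrite -x1 (reindex (fun t : idx => (t.1, t.2 + c))) /=.
    by apply: eq_bigr => -[i b] _; rewrite join_shiftE addrK.
  by exists (fun t : idx => (t.1, t.2 - c)) => -[i b] _ /=; rewrite ?addrK ?subrK.
move=> i b b' bb'; rewrite !join_shiftE x2 //.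
by apply: contra bb' => /eqP /addIr ->.
Qed.

Lemma norm_join x : join x -> `|x| <= 1.
Proof.
move=> [x0 x1 _]; rewrite /Num.norm /= mx_normrE; apply/bigmax_leP; split=> //.
move=> [i k] _ /=; rewrite ord1 -(enum_valK k) -/(jcoord x _) ger0_norm //.
by rewrite -x1 (bigD1 (enum_val k)) //= lerDl sumr_ge0.
Qed.

Lemma jcoord_continuous t : continuous (fun x => jcoord x t).
Proof. exact: coord_continuous. Qed.

Lemma compact_join : compact join.
Proof.
apply: (@subclosed_compact _ _
    [set x : V | forall k, `[0, 1]%classic (x ord0 k)]%classic).
- have -> : join = ((\bigcap_(t : idx) ((jcoord^~ t) @^-1` [set y | 0 <= y])) `&`
      ((fun x => \sum_t jcoord x t) @^-1` [set 1]) `&`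
      \bigcap_(p in [set p : 'I_N.+1 * ('F_q * 'F_q) | p.2.1 != p.2.2])
        ((fun x => jcoord x (p.1, p.2.1) * jcoord x (p.1, p.2.2)) @^-1` [set 0]))%classic.
    apply/seteqP; split=> x.
      move=> [x0 x1 x2]; split; first by split=> // t _; apply: x0.
      by move=> [i [b b']] /= bb'; apply: x2.
    move=> [[x0 x1] x2]; split=> //; first by move=> t; apply: (x0 t).
    by move=> i b b' bb'; apply: (x2 (i, (b, b'))).
  apply: closedI; first apply: closedI.
  + apply: closed_bigI => t _; apply: closed_comp; last exact: closed_ge.
    by move=> x _; apply: jcoord_continuous.
  + apply: closed_comp; last exact: closed_eq.
    move=> x _; apply: continuous_big => [|t _]; first exact: add_continuous.
    exact: jcoord_continuous.
  apply: closed_bigI => p _; apply: closed_comp; last exact: closed_eq.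
  by move=> x _; apply: continuousM; exact: jcoord_continuous.
- by apply: (@rV_compact R _ (fun=> `[0, 1]%classic)) => _; exact: segment_compact.
move=> x [x0 x1 _] k /=; rewrite in_itv /= -(enum_valK k) -/(jcoord x _) x0.
by rewrite -x1 (bigD1 (enum_val k)) //= lerDl sumr_ge0.
Qed.

Definition jvertex (i : nat) : V := jrow (fun t => (t == (inord i, 0))%:R).

Lemma jvertexE c i t :
  jcoord (join_shift c (jvertex i)) t = (t == (inord i, c))%:R.
Proof.
case: t => j b; rewrite join_shiftE jrowE /= !xpair_eqE.
by rewrite subr_eq0.
Qed.

(** A closed simplex of the join; unlike [join] itself it is convex. *)
Definition join_face (a : 'I_N.+1 -> 'F_q) x := [/\ forall t, 0 <= jcoord x t,
  \sum_t jcoord x t = 1 & forall i b, b != a i -> jcoord x (i, b) = 0].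

Lemma jvertex_face a i : join_face a (join_shift (a (inord i)) (jvertex i)).
Proof.
split=> [t||j b bj].
- by rewrite jvertexE ler0n.
- rewrite (bigD1 (inord i, a (inord i))) //= jvertexE eqxx big1 ?addr0 // => t.
  by rewrite jvertexE => /negPf ->.
rewrite jvertexE xpair_eqE; case: eqP => //= ji.
by rewrite -ji (negPf bj).
Qed.

Lemma join_face_join a x : join_face a x -> join x.
Proof.
move=> [x0 x1 x2]; split=> // i b b' bb'.
case: (eqVneq b (a i)) => [ba|/x2 ->]; last by rewrite mul0r.
by rewrite (x2 i b') ?mulr0 // -ba eq_sym.
Qed.

Lemma join_jvertex i : join (jvertex i).
Proof.
rewrite -[jvertex i]join_shift0; exact: join_face_join (jvertex_face (fun=> 0) i).
Qed.

Lemma jcoord_bary s t :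
  jcoord (bary s) t = (size s)%:R^-1 * \sum_(x <- s) jcoord x t.
Proof. by rewrite /jcoord mxE summxE. Qed.

Lemma avg_closed_join_face a : avg_closed (join_face a).
Proof.
move=> s s0 sF; split=> [t||i b bi].
- rewrite jcoord_bary mulr_ge0 ?invr_ge0 // big_seq sumr_ge0 // => x /sF[]; exact.
- under eq_bigr do rewrite jcoord_bary.
  rewrite -mulr_sumr exchange_big /=.
  rewrite (eq_big_seq (fun=> 1)) => [|x /sF[]//].
  rewrite big_const_seq count_predT iter_addr_0 mulVf //.
  by rewrite pnatr_eq0 size_eq0.
rewrite jcoord_bary big_seq big1 ?mulr0 // => x /sF[_ _]; exact.
Qed.

End Join.

Lemma continuous_row (R : realType) (T : topologicalType) n (f : T -> 'rV[R]_n) :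
  (forall k, continuous (fun x => f x ord0 k)) -> continuous f.
Proof.
move=> cf x; apply/cvgrPdist_lt => e e0.
have : \forall y \near x, forall k, `|f x ord0 k - f y ord0 k| < e.
  by apply: filter_forall => k; have /cvgrPdist_lt /(_ e e0) := cf k x.
apply: filterS => y xy; rewrite /Num.norm /= mx_normrE; apply/bigmax_ltP; split=> //.
by move=> [i k] _ /=; rewrite ord1 !mxE.
Qed.

Lemma join_shift_coord_continuous (R : realType) q N d
    (h : 'rV[R]_#|{: 'I_N.+1 * 'F_q}| -> 'rV[R]_d) c i :
  continuous h -> continuous (fun x => h (join_shift c x) ord0 i).
Proof.
move=> h_cont x; apply: (@continuous_comp _ _ _ (fun x => h (join_shift c x))
    (fun y : 'rV[R]_d => y ord0 i)); last exact: coord_continuous.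
apply: continuous_comp; last exact: h_cont.
apply: continuous_row => k y.
under eq_fun do rewrite /join_shift mxE.
exact: coord_continuous.
Qed.

(** * Equivariant labels from gaps along orbits *)

Section BorsukUlam.
Variables (R : realType) (q d : nat).
Notation N := #|{: 'I_d * 'I_q}|.
Notation V := 'rV[R]_#|{: 'I_N.+1 * 'F_q}|.
Hypotheses (q_prime : prime q) (q_gt2 : (2 < q)%N) (d_gt0 : (0 < d)%N).
Variable h : V -> 'rV[R]_d.
Hypothesis h_cont : continuous h.

Let orbit_val (x : V) (i : 'I_d) (c : 'F_q) : R := h (join_shift c x) ord0 i.

Let orbit_val_shift c x i b : orbit_val (join_shift c x) i b = orbit_val x i (b + c).
Proof. by rewrite /orbit_val join_shiftD. Qed.

Variable g : R.
Hypothesis g_gt0 : 0 < g.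

Let gap_set x i (S : {set 'F_q}) := forall u w, u \in S -> w \notin S ->
  orbit_val x i w + g <= orbit_val x i u.

(** Otherwise take [u] in [S] only and [w] in [S'] only. The gaps put [u] above [w] at [x] and [w]
    above [u] at [y], by at least [g] each, while both values change by less than [g]. *)
Let gap_set_uniq x y i S S' : gap_set x i S -> gap_set y i S' -> #|S| = #|S'| ->
  (forall c, `|orbit_val x i c - orbit_val y i c| < g) -> S = S'.
Proof.
move=> gS gS' SS' xy; apply/eqP; apply: contraT => nSS'.
have /fintype.subsetPn[u uS uS'] : ~~ (S \subset S').
  by apply: contra nSS' => sub; rewrite eqEcard sub SS' leqnn.
have /fintype.subsetPn[w wS' wS] : ~~ (S' \subset S).
  by apply: contra nSS' => sub; rewrite eq_sym eqEcard sub SS' leqnn.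
have := gS u w uS wS; have := gS' w u wS' uS'.
by have := xy u; have := xy w; rewrite !ltr_norml; lra.
Qed.

Let gap_set_shift c x i S :
  gap_set (join_shift c x) i S -> gap_set x i [set j + c | j in S].
Proof.
move=> gS _ w /imsetP[j jS ->] wS; rewrite -(subrK c w) -!(orbit_val_shift c).
apply: gS => //; apply: contra wS => wS; apply/imsetP; exists (w - c) => //.
by rewrite subrK.
Qed.

(** The index [p], a coordinate and the size of a gap set, is an orbit invariant. The size is
    between 1 and [q - 1], so it is invertible mod [q]. *)
Let has_gap x (p : 'I_d * 'I_q) : bool :=
  `[< exists S, [/\ gap_set x p.1 S, #|S| = p.2 & (0 < p.2)%N] >].

Let has_gap_shift c x : has_gap (join_shift c x) =1 has_gap x.
Proof.
have imp b y p : has_gap (join_shift b y) p -> has_gap y p.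
  move=> /asboolP[S [gS Sp p0]]; apply/asboolP; exists [set j + b | j in S].
  by split=> //; [exact: gap_set_shift|rewrite card_imset //; exact: addIr].
move=> p; apply/idP/idP; first exact: imp.
move=> xp; apply: (imp (- c)); by rewrite join_shiftD addNr join_shift0.
Qed.

Let p0 : 'I_d * 'I_q := (Ordinal d_gt0, Ordinal (prime_gt0 q_prime)).

(* A shift by [c] translates gap sets by [- c], so the opposite of their mean moves
   by [c]; the mean exists in 'F_q because a gap set has fewer than [q] elements. *)
Let lab_pos x (p : 'I_d * 'I_q) : 'F_q :=
  if [pick S : {set 'F_q} | `[< gap_set x p.1 S >] && (#|S| == p.2)] is Some B
  then - (\sum_(j in B) j) / #|B|%:R else 0.

Let lab x : 'F_q * 'I_N :=
  if [pick p | has_gap x p] is Some p then (lab_pos x p, enum_rank p)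
  else (0, enum_rank p0).

Let lab_posE x (p : 'I_d * 'I_q) S : gap_set x p.1 S -> #|S| = p.2 ->
  lab_pos x p = - (\sum_(j in S) j) / #|S|%:R.
Proof.
move=> gS Sp; rewrite /lab_pos; case: pickP => [S'|/(_ S)]; last first.
  by rewrite Sp eqxx andbT => /asboolP.
move=> /andP[/asboolP gS' /eqP S'p].
rewrite (gap_set_uniq gS' gS) // ?S'p ?Sp // => c.
by rewrite subrr normr0.
Qed.

Let labP x : (exists p, has_gap x p) ->
  exists (p : 'I_d * 'I_q) (S : {set 'F_q}), [/\ gap_set x p.1 S, #|S| = p.2, (0 < p.2)%N,
                  [pick p | has_gap x p] = Some p
                & lab x = (- (\sum_(j in S) j) / #|S|%:R, enum_rank p)].
Proof.
move=> [p' hp']; rewrite /lab; case: pickP => [p|/(_ p')]; last by rewrite hp'.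
move=> /asboolP[S [gS Sp p0']]; exists p, S; split=> //.
by rewrite (lab_posE gS Sp).
Qed.

Let lab_shift c x : (exists p, has_gap x p) ->
  lab (join_shift c x) = shift_label c (lab x).
Proof.
move=> [p0' hp0].
have [|p [S [gS Sp _ pickx labx]]] := @labP x; first by exists p0'.
have [|p' [S' [gS' Sp' p0'' pickx' labx']]] := @labP (join_shift c x).
  by exists p0'; rewrite has_gap_shift.
have [pp] : Some p' = Some p.
  by rewrite -pickx -pickx'; apply: eq_pick => r; rewrite has_gap_shift.
rewrite {p'}pp in gS' Sp' p0'' pickx' labx' *.
have card' : #|[set j + c | j in S']| = #|S'| by rewrite card_imset //; exact: addIr.
have SS' : S = [set j + c | j in S'].
  apply: gap_set_uniq gS (gap_set_shift gS') _ _; first by rewrite card' Sp Sp'.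
  by move=> b; rewrite subrr normr0.
rewrite labx labx' /shift_label /=; congr (_, _).
rewrite SS' card' big_imset /=; last by move=> ? ? _ _; exact: addIr.
have n0 : #|S'|%:R != 0 :> 'F_q.
  rewrite Sp' -(dvdn_pcharf (pchar_Fp q_prime)); apply/negP => /dvdn_leq.
  by rewrite p0'' => /(_ isT); rewrite leqNgt ltn_ord.
by rewrite big_split /= sumr_const -[c *+ _]mulr_natr; field.
Qed.

Let F_q_two (a : 'F_q) : a = - a -> a = 0.
Proof.
move=> /eqP; rewrite -addr_eq0 -mulr2n -mulr_natr mulf_eq0 => /orP[/eqP//|].
rewrite -(dvdn_pcharf (pchar_Fp q_prime)) => /dvdn_leq.
by move=> /(_ isT); rewrite leqNgt q_gt2.
Qed.

Lemma no_gap_sets : ~ forall x, join x -> exists (i : 'I_d) (S : {set 'F_q}),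
  [/\ forall u w, u \in S -> w \notin S ->
        h (join_shift w x) ord0 i + g <= h (join_shift u x) ord0 i,
     (0 < #|S|)%N & (#|S| < q)%N].
Proof.
move=> gapE; have gaps x : join x -> exists p, has_gap x p.
  move=> /gapE[i [S [gS S0 Sq]]]; exists (i, Ordinal Sq).
  by apply/asboolP; exists S.
have [e e0 eP] := @compact_unif_continuous R V _ ('I_d * 'F_q)%type
  (fun (p : 'I_d * 'F_q) x => orbit_val x p.1 p.2) _ (@compact_join R q N)
  (fun p => @join_shift_coord_continuous _ _ _ _ h p.2 p.1 h_cont) g_gt0.
apply: (@no_equivariant_labelling q R V (fun c => [the {linear V -> V} of join_shift c])
   _ _ (@jvertex R q N) N (fun x => join x) lab 2 e) => //.
- exact: join_shiftD.
- exact: join_shift0.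
- move=> i j a b; apply: (le_trans (ler_normB _ _)).
  by rewrite -[2]/(1 + 1); apply: lerD; apply: norm_join;
    apply: join_shift_join; apply: join_jvertex.
- move=> a; exists (join_face (fun i : 'I_N.+1 => a i)); split.
  + exact: avg_closed_join_face.
  + by move=> x; apply: join_face_join.
  by move=> i iN; have := @jvertex_face R q N (fun i : 'I_N.+1 => a i) i; rewrite inordK.
- by move=> c x Ex; apply: lab_shift; apply: gaps.
move=> x y Ex Ey xy.
have [p [S [gS Sp _ _ ->]]] := labP (gaps x Ex).
have [p' [S' [gS' Sp' _ _ ->]]] := labP (gaps y Ey).
move=> /= /enum_rank_inj pp; rewrite -{p'}pp in gS' Sp' *.
rewrite (gap_set_uniq gS gS') ?Sp ?Sp' // => c.
exact: (eP x y (p.1, c)).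
Qed.

End BorsukUlam.

(** If [h] is constant on no orbit, compactness bounds its spread along orbits below by some [g],
    and a spread [g] over [q] values leaves a gap of [g / q]. *)
Theorem join_borsuk_ulam (R : realType) (q d : nat)
    (h : 'rV[R]_#|{: 'I_#|{: 'I_d * 'I_q}|.+1 * 'F_q}| -> 'rV[R]_d) :
  prime q -> (2 < q)%N -> (0 < d)%N -> continuous h ->
  exists2 x, join x & forall c, h (join_shift c x) = h x.
Proof.
move=> q_prime q_gt2 d_gt0 h_cont; apply: contrapT => none.
pose F (p : 'I_d * 'F_q) x := `|h (join_shift p.2 x) ord0 p.1 - h x ord0 p.1|.
have F_cont p : continuous (F p).
  have c0 : continuous (fun x => h x ord0 p.1).
    have := @join_shift_coord_continuous _ _ _ _ h 0 p.1 h_cont.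
    by under eq_fun do rewrite join_shift0.
  have cp := @join_shift_coord_continuous _ _ _ _ h p.2 p.1 h_cont.
  by move=> x; exact: (cvg_norm (cvgB (cp x) (c0 x))).
have [x|g g0 gP] := compact_positive_gap (@compact_join R q _) F_cont.
  move=> Ex; apply: contrapT => nx; apply: none; exists x => // c.
  apply/rowP => i; apply/eqP; rewrite -subr_eq0 -normr_eq0.
  apply: contraT => n0; case: nx; exists (i, c).
  by rewrite lt_neqAle eq_sym n0 normr_ge0.
have gq : 0 < g / q%:R by rewrite divr_gt0 // ltr0n prime_gt0.
apply: (no_gap_sets q_prime q_gt2 d_gt0 h_cont gq) => x Ex.
have [[i c] Fic] := gP x Ex.
pose a b := h (join_shift b x) ord0 i.
have [j [k jk]] : exists j k, a k + g <= a j.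
  move: Fic; rewrite /F /= -[in h x](join_shift0 x) -/(a c) -/(a 0) ler_normr.
  by case/orP => ac; [exists c, 0|exists 0, c]; lra.
have [S [jS kS gS]] := exists_gap_set g0 jk.
have Sq : (#|S| < q)%N.
  rewrite -[X in (_ < X)%N](card_Fp q_prime) -cardsT.
  apply: proper_card; apply/fintype.properP; split.
    exact: finset.subsetT.
  by exists k; rewrite ?inE.
exists i, S; split=> //; last by apply/card_gt0P; exists j.
by move=> u w uS wS; have := gS u w uS wS; rewrite card_Fp.
Qed.

(** * Embedding a simplex in a cyclic orbit *)

Section Trigonometry.
Local Open Scope classical_set_scope.
Variable R : realType.
Implicit Types x y w : R.

Lemma derive_bound (f df : R -> R) (M a b : R) :
  (forall x, is_derive x 1 f (df x)) ->
  (forall x, Num.min a b <= x <= Num.max a b -> `|df x| <= M) ->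
  `|f b - f a| <= M * `|b - a|.
Proof.
move=> fdf dfM.
have cf x y : {within `[x, y], continuous f}.
  apply: continuous_subspaceT => z; apply: differentiable_continuous.
  by apply/derivable1_diffP; case: (fdf z).
case: (leP a b) dfM => [ab|/ltW ba] dfM.
  have [c cab ->] := @MVT_segment R f df a b ab (fun x _ => fdf x) (cf a b).
  by rewrite normrM ler_wpM2r // dfM //; move: cab; rewrite in_itv.
rewrite distrC [`|b - a|]distrC.
have [c cab ->] := @MVT_segment R f df b a ba (fun x _ => fdf x) (cf b a).
by rewrite normrM ler_wpM2r // dfM //; move: cab; rewrite in_itv.
Qed.

Lemma cos_lipschitz x y : `|cos x - cos y| <= `|x - y|.
Proof.
rewrite -[leRHS]mul1r; apply: (@derive_bound cos (fun x => - sin x)) => z _.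
by rewrite normrN sin_max.
Qed.

Lemma norm_sin_le x : `|sin x| <= `|x|.
Proof.
have := @derive_bound sin cos 1 0 x.
by rewrite sin0 !subr0 mul1r; apply=> z _; apply: cos_max.
Qed.

Lemma norm_sin_sub_le x : `|sin x - x| <= `|x| ^+ 2.
Proof.
have dsin (z : R) : is_derive z 1 (fun z : R => sin z - z) (cos z - 1).
  exact: (@is_deriveB _ _ _ sin id).
have := derive_bound dsin; move=> /(_ `|x| 0 x).
rewrite sin0 !subr0 -expr2; apply=> z.
rewrite -[X in _ - X]cos0 => zx; apply: (le_trans (cos_lipschitz _ _)).
move: zx; rewrite subr0 ler_norml; case: (leP 0 x) => x0.
  by rewrite ger0_norm //; lra.
by rewrite ltr0_norm //; lra.
Qed.

(** With [h = x / 2] the quantity is [4 * (sin h - h) * (sin h + h)], and the factors are bounded by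
    [h ^ 2] and [2 * |h|]. *)
Lemma norm_cos_quadratic x : `|2 - 2 * cos x - x ^+ 2| <= `|x| ^+ 3.
Proof.
set h := x / 2.
have xh : x = h *+ 2 by rewrite -mulr_natr divfK.
have -> : 2 - 2 * cos x - x ^+ 2 = 4 * ((sin h - h) * (sin h + h)).
  by rewrite xh cos_mulr2n cos2sin2; ring.
have -> : `|x| ^+ 3 = 4 * (`|h| ^+ 2 * (`|h| + `|h|)).
  by rewrite xh normrMn; ring.
rewrite normrM ger0_norm // ler_wpM2l // normrM ler_pM //.
  exact: norm_sin_sub_le.
by apply: (le_trans (ler_normD _ _)); rewrite lerD2r norm_sin_le.
Qed.

Lemma cos_periodic_int x (n : int) : cos (x + 2 * pi * n%:~R) = cos x.
Proof.
have per (k : nat) y : cos (y + 2 * pi * k%:R) = cos y.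
  rewrite -[RHS](periodicn (@cosD2pi R) k) -mulrnA -[pi *+ _]mulr_natr natrM.
  by congr cos; ring.
case: n => k; first exact: per.
by rewrite NegzE -[LHS](per k.+1); congr cos; rewrite mulrNz; ring.
Qed.

End Trigonometry.

(* The [i]-th base [B] digit of [x] is the leading one of the fractional part of
   [theta i], so multiplying [x] by [B ^ i] moves it to the front. *)
Lemma digits_approx (R : realType) (B m : nat) (theta : nat -> R) : (0 < B)%N ->
  exists2 x : R, 0 <= x < 1 & forall i, (i < m)%N ->
    exists n : int, `|B%:R ^+ i * x - theta i - n%:~R| <= B%:R^-1.
Proof.
move=> B0; elim: m theta => [|m IH] theta.
  by exists 0; rewrite ?lexx ?ltr01.
have [y /andP[y0 y1] yP] := IH (fun i => theta i.+1).
have B0' : 0 < B%:R :> R by rewrite ltr0n.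
set f := theta 0%N - (Num.floor (theta 0%N))%:~R.
have f0 : 0 <= f by rewrite subr_ge0 floor_le.
have f1 : f < 1 by rewrite ltrBlDl -(intrD _ _ 1) floorD1_gt.
set e := Num.floor (B%:R * f).
have e0 : 0 <= e by rewrite floor_ge0 mulr_ge0 // ltW.
have eB : e < B%:Z by rewrite floor_lt_int /= -[ltRHS]mulr1 ltr_pM2l.
have le_e : e%:~R <= B%:R * f by exact: floor_le.
have lt_e : B%:R * f < e%:~R + 1 by rewrite -(intrD _ _ 1) floorD1_gt.
exists ((e%:~R + y) / B%:R).
  rewrite divr_ge0 ?addr_ge0 ?ler0z ?(ltW B0') //= ltr_pdivrMr // mul1r.
  have : (e + 1)%:~R <= B%:R :> R by rewrite -[leRHS]/(B%:Z%:~R) ler_int lezD1.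
  by rewrite intrD; lra.
case=> [|i] im.
  exists (- Num.floor (theta 0%N)); rewrite expr0 mul1r mulrNz.
  have -> : (e%:~R + y) / B%:R - theta 0%N - - (Num.floor (theta 0%N))%:~R
    = (e%:~R + y - B%:R * f) / B%:R.
    by rewrite /f; field; rewrite gt_eqF.
  rewrite normrM normfV [X in _ / X]ger0_norm ?(ltW B0') //.
  by rewrite ler_pdivrMr // mulVf ?gt_eqF // ler_norml; lra.
have [n nP] := yP i im.
exists (n + e * (B%:Z) ^+ i).
rewrite exprSr.
have -> : B%:R ^+ i * B%:R * ((e%:~R + y) / B%:R) - theta i.+1 -
    (n + e * B%:Z ^+ i)%:~R = B%:R ^+ i * y - theta i.+1 - n%:~R :> R.
  rewrite rmorphD rmorphM rmorphXn /=.
  by field; rewrite gt_eqF.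
exact: nP.
Qed.

(* [D] is the squared distance of some cyclic (translation invariant)
   configuration [u] of [q] points in Euclidean space. *)
Definition orbit_metric (R : realType) (q : nat) (D : 'F_q -> R) :=
  exists (J : finType) (u : 'F_q -> J -> R),
    forall a b, \sum_j (u a j - u b j) ^+ 2 = D (a - b).

Section OrbitMetric.
Variables (R : realType) (q : nat).
Implicit Types D : 'F_q -> R.

Lemma orbit_metric0 : orbit_metric (fun _ : 'F_q => 0 : R).
Proof. by exists void, (fun _ _ => 0) => a b; rewrite big1 // => -[]. Qed.

Lemma orbit_metricD D1 D2 : orbit_metric D1 -> orbit_metric D2 ->
  orbit_metric (fun t => D1 t + D2 t).
Proof.
move=> [J1 [u1 H1]] [J2 [u2 H2]].
exists (J1 + J2)%type, (fun a j => match j with inl j => u1 a j | inr j => u2 a j end).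
by move=> a b; rewrite big_sumType /= H1 H2.
Qed.

Lemma orbit_metricZ (c : R) D : 0 <= c -> orbit_metric D ->
  orbit_metric (fun t => c * D t).
Proof.
move=> c0 [J [u H]]; exists J, (fun a j => Num.sqrt c * u a j) => a b.
rewrite -H mulr_sumr; apply: eq_bigr => j _.
by rewrite -mulrBr exprMn sqr_sqrtr.
Qed.

Lemma orbit_metric_sum (I : finType) (D : I -> 'F_q -> R) :
  (forall i, orbit_metric (D i)) -> orbit_metric (fun t => \sum_i D i t).
Proof.
move=> H; elim: index_enum => [|i s IH].
  under eq_fun do rewrite big_nil; exact: orbit_metric0.
under eq_fun do rewrite big_cons; exact: orbit_metricD.
Qed.

Hypothesis q_prime : prime q.

Definition cyc_angle (tau : nat) (x : R) : R := 2 * pi * (tau%:R * x / q%:R).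

(** The representative of [c] differs from [x - y] by a multiple of [q], hence the angles by a
    multiple of [2 * pi], as [tau] is an integer. *)
Lemma cos_cyc_angle tau (c : 'F_q) (x y : nat) : c + y%:R = x%:R ->
  cos (cyc_angle tau c%:R) = cos (cyc_angle tau x%:R - cyc_angle tau y%:R).
Proof.
move=> cyx; have q0 : q%:R != 0 :> R by rewrite pnatr_eq0 -lt0n prime_gt0.
have : (c + y)%N = x %[mod q].
  by rewrite -!(val_Fp_nat q_prime) natrD natr_Zp cyx.
move=> e; have e1 := divn_eq (c + y) q; have e2 := divn_eq x q.
have {e1 e2} : (c + y)%:R - x%:R = (((c + y) %/ q)%:R - (x %/ q)%:R) * q%:R :> R.
  by rewrite {1}e1 {1}e2 e !natrD !natrM; ring.
rewrite natrD => e1.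
rewrite -[RHS](cos_periodic_int _ (tau%:Z * ((c + y) %/ q)%:Z - tau%:Z * (x %/ q)%:Z)).
congr cos; rewrite /cyc_angle rmorphB !rmorphM /=.
have -> : c%:R = x%:R - y%:R + (((c + y) %/ q)%:R - (x %/ q)%:R) * q%:R :> R.
  by rewrite -e1; ring.
by field.
Qed.

(** Squared chords between [q]-th roots of unity, traversed with step [tau]. *)
Lemma orbit_metric_cos tau :
  orbit_metric (fun t : 'F_q => 2 - 2 * cos (cyc_angle tau t%:R)).
Proof.
exists bool, (fun (a : 'F_q) j => if j then cos (cyc_angle tau a%:R)
                                  else sin (cyc_angle tau a%:R)) => a b.
rewrite big_bool (@cos_cyc_angle tau (a - b) a b) ?natr_Zp ?subrK //= cosB.
have := cos2Dsin2 (cyc_angle tau a%:R); have := cos2Dsin2 (cyc_angle tau b%:R).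
by lra.
Qed.

(** Realized by the unit vectors [al e_a + be e_(a + t0)] with [al * be = gamma]: two distinct ones
    have nonzero inner product only if their indices differ by [t0] or [- t0]. *)
Lemma orbit_metric_pair (t0 : 'F_q) (gamma : R) : t0 != 0 -> `|gamma| <= 1 / 2 ->
  orbit_metric (fun t : 'F_q => if t == 0 then 0
    else 2 - 2 * gamma * ((t == t0)%:R + (- t == t0)%:R)).
Proof.
move=> t00; rewrite ler_norml => /andP[g1 g2].
(* [s] and [r] are the sum and the difference of the coefficients [al] and [be]. *)
set s := Num.sqrt (1 + 2 * gamma); set r := Num.sqrt (1 - 2 * gamma).
have s2 : s ^+ 2 = 1 + 2 * gamma by rewrite sqr_sqrtr //; lra.
have r2 : r ^+ 2 = 1 - 2 * gamma by rewrite sqr_sqrtr //; lra.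
pose al := (s + r) / 2; pose be := (s - r) / 2.
have ab1 : al ^+ 2 + be ^+ 2 = 1.
  have -> : al ^+ 2 + be ^+ 2 = (s ^+ 2 + r ^+ 2) / 2 by rewrite /al /be; field.
  by rewrite s2 r2; field.
have abg : al * be = gamma.
  have -> : al * be = (s ^+ 2 - r ^+ 2) / 4 by rewrite /al /be; field.
  by rewrite s2 r2; field.
pose e (x j : 'F_q) : R := (j == x)%:R.
have ee x y : \sum_j e x j * e y j = (x == y)%:R.
  rewrite (bigD1 x) //= /e eqxx mul1r big1 ?addr0 // => j /negPf ->.
  by rewrite mul0r.
exists 'F_q, (fun a j => al * e a j + be * e (a + t0) j) => a b.
transitivity (al ^+ 2 * (\sum_j e a j * e a j + \sum_j e b j * e b j
      - 2 * \sum_j e a j * e b j)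
  + be ^+ 2 * (\sum_j e (a + t0) j * e (a + t0) j + \sum_j e (b + t0) j * e (b + t0) j
      - 2 * \sum_j e (a + t0) j * e (b + t0) j)
  + 2 * (al * be) * (\sum_j e a j * e (a + t0) j + \sum_j e b j * e (b + t0) j
      - \sum_j e a j * e (b + t0) j - \sum_j e (a + t0) j * e b j)).
  rewrite !mulr_sumr -!sumrN -!big_split /= !mulr_sumr -!big_split /=.
  by apply: eq_bigr => j _; ring.
rewrite !ee !eqxx (inj_eq (addIr t0)) abg.
have nt x : (x == x + t0) = false.
  by rewrite -[in LHS](addr0 x) -addrA (inj_eq (addrI x)) add0r eq_sym (negPf t00).
have -> : al ^+ 2 = 1 - be ^+ 2 by rewrite -ab1; ring.
rewrite !nt subr_eq0 opprB !subr_eq [t0 + b]addrC [t0 + a]addrC [b == _]eq_sym.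
case: (eqVneq a b) => [->|_]; first by rewrite [b + t0 == b]eq_sym nt /=; ring.
by rewrite /=; ring.
Qed.

End OrbitMetric.

(** For [B >= 3] a power exceeds the sum of any two smaller powers, so the largest exponent occurs
    on both sides and cancels. *)
Lemma expn_sidon B i j k l : (3 <= B)%N -> (B ^ i + B ^ l = B ^ k + B ^ j)%N ->
  i != j -> i = k /\ l = j.
Proof.
move=> B3; have B1 : (1 < B)%N by lia.
have big a b c x : (B ^ a + B ^ b = B ^ c + B ^ x)%N -> (c < a)%N -> (x < a)%N -> False.
  move=> e ca xa; have := leq_pexp2l (ltnW B1) ca; have := leq_pexp2l (ltnW B1) xa.
  have Bb : (0 < B ^ b)%N by rewrite expn_gt0 ltnW.
  by rewrite !expnS; nia.
have inj a b : (B ^ a = B ^ b)%N -> a = b.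
  by move=> /eqP; rewrite eqn_exp2l // => /eqP.
move=> e /eqP nij.
have h1 : ~ (k < i /\ j < i)%N by case; apply: big e.
have h2 : ~ (k < l /\ j < l)%N by case; apply: (big l i) => //; lia.
have h3 : ~ (i < k /\ l < k)%N by case; apply: big (esym e).
have h4 : ~ (i < j /\ l < j)%N by case; apply: (big j k) => //; lia.
have f1 : i = k -> l = j by move=> ik; apply: inj; rewrite ik in e; lia.
have f2 : l = j -> i = k by move=> lj; apply: inj; rewrite lj in e; lia.
have f3 : l = k -> i = j by move=> lk; apply: inj; rewrite lk in e; lia.
lia.
Qed.

(** * Simultaneous approximation by cyclic metrics *)

Section Approximation.
Variable R : realType.

Lemma approx_cyc_angle (q B m tau : nat) (v : 'I_m -> R) (s del : R) (i j : 'I_m) :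
  prime q ->
  (forall i : 'I_m, exists n : int,
     `|tau%:R * B%:R ^+ i / q%:R - s * v i / (2 * pi) - n%:~R| <= del) ->
  `|cos (cyc_angle q tau (((B ^ i)%:R - (B ^ j)%:R)%R : 'F_q)%:R) - cos (s * (v i - v j))|
    <= 4 * pi * del.
Proof.
move=> q_prime H; have [ni Hi] := H i; have [nj Hj] := H j.
rewrite (@cos_cyc_angle R q q_prime tau _ (B ^ i) (B ^ j)) ?subrK //.
have pi0 := @pi_gt0 R.
set ei := (X in `|X|) in Hi; set ej := (X in `|X|) in Hj.
rewrite -(cos_periodic_int (s * (v i - v j)) (ni - nj)).
apply: (le_trans (cos_lipschitz _ _)).
have -> : cyc_angle q tau (B ^ i)%:R - cyc_angle q tau (B ^ j)%:R -
    (s * (v i - v j) + 2 * pi * (ni - nj)%:~R) = 2 * pi * (ei - ej).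
  have pn0 : pi != 0 :> R by rewrite gt_eqF.
  have qn0 : q%:R != 0 :> R by rewrite pnatr_eq0 -lt0n prime_gt0.
  rewrite /cyc_angle /ei /ej !natrX rmorphB /=.
  by move: (@pi R) pn0 => p pn0; field; rewrite pn0 qn0.
rewrite normrM ger0_norm ?mulr_ge0 ?(ltW pi0) //.
rewrite (_ : 4 * pi * del = 2 * pi * (del + del)); last by ring.
rewrite ler_wpM2l ?mulr_ge0 ?(ltW pi0) //.
by apply: (le_trans (ler_normB _ _)); apply: lerD.
Qed.

Lemma archi_inv (e : R) : 0 < e -> exists n : nat, forall k, (n < k)%N -> k%:R^-1 <= e.
Proof.
move=> e0; exists (Num.truncn e^-1) => k nk.
have k0 : 0 < k%:R :> R by rewrite ltr0n; apply: leq_ltn_trans nk.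
rewrite -[leRHS]invrK lef_pV2 ?posrE ?invr_gt0 //.
have ei0 : 0 <= e^-1 by rewrite invr_ge0 ltW.
have /andP[_ /ltW le1] := truncn_itv ei0.
by apply: (le_trans le1); rewrite ler_nat.
Qed.

(** For small [s], [(2 - 2 * cos (s * x)) / s ^ 2] approximates [x ^ 2]. [digits_approx] yields
    [tau / q] for which the powers [B ^ i] have angles near [s * v l i]; the same [B] and [q] serve
    all [l]. *)
Lemma cyclic_approx (k m : nat) (v : 'I_k -> 'I_m -> R) (eps : R) : 0 < eps ->
  exists B q : nat, [/\ (3 <= B)%N, prime q, (2 * B ^ m < q)%N & forall l : 'I_k,
    exists (c : R) (tau : nat), 0 <= c /\ forall i j : 'I_m,
    `|c * (2 - 2 * cos (cyc_angle q tau (((B ^ i)%:R - (B ^ j)%:R)%R : 'F_q)%:R))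
      - (v l i - v l j) ^+ 2| <= eps].
Proof.
move=> eps0; have pi0 := @pi_gt0 R.
pose W := 1 + \sum_l \sum_i \sum_j `|v l i - v l j|.
have W0 : 0 < W.
  rewrite ltr_pwDl // sumr_ge0 // => l _; rewrite sumr_ge0 // => i _.
  by rewrite sumr_ge0.
have vW l i j : `|v l i - v l j| <= W.
  have le_sum (I : finType) (f : I -> R) x : (forall y, 0 <= f y) -> f x <= \sum_y f y.
    by move=> f0; rewrite (bigD1 x) //= lerDl sumr_ge0.
  apply: (@le_trans _ _ (\sum_l \sum_i \sum_j `|v l i - v l j|)); last by rewrite lerDr.
  apply: le_trans (le_sum _ _ l _) => [|l']; last first.
    by apply: sumr_ge0 => i' _; apply: sumr_ge0.
  apply: le_trans (le_sum _ _ i _) => [|i']; last exact: sumr_ge0.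
  exact: le_sum.
(* Makes the cubic error [(s * W) ^ 3] equal to [eps / 2 * s ^ 2]. *)
pose s := eps / (2 * W ^+ 3).
have s0 : 0 < s by rewrite /s divr_gt0 // mulr_gt0 // exprn_gt0.
(* Makes the angular error [2 * (4 * pi * del)] equal to [eps / 2 * s ^ 2]. Half of [del] goes to
   the digits in base [B], half to rounding [q * x] to an integer. *)
pose del := eps * s ^+ 2 / (16 * pi).
have del0 : 0 < del by rewrite /del divr_gt0 // mulr_gt0 // exprn_gt0.
have del2 : 0 < del / 2 by rewrite divr_gt0.
have [n1 n1P] := archi_inv del2.
pose B := (n1 + 3)%N.
have B0 : 0 < B%:R :> R by rewrite ltr0n /B addn3.
have [n2 n2P] := archi_inv (divr_gt0 del2 (exprn_gt0 m B0)).
have [q qbig q_prime] := prime_above (n2 + 2 * B ^ m)%N.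
have q0 : 0 < q%:R :> R by rewrite ltr0n prime_gt0.
exists B, q; split; rewrite ?q_prime //;
  [exact: leq_addl|exact: leq_ltn_trans (leq_addl _ _) qbig|] => l.
have [|x /andP[x0 x1] xP] := @digits_approx R B m
  (fun i => if insub i is Some i' then s * v l i' / (2 * pi) else 0).
  by rewrite /B addn3.
exists (s ^- 2), (Num.truncn (q%:R * x)); split; first by rewrite invr_ge0 exprn_ge0 // ltW.
have tauP (i : 'I_m) : exists n : int,
   `|(Num.truncn (q%:R * x))%:R * B%:R ^+ i / q%:R - s * v l i / (2 * pi) - n%:~R| <= del.
  have [n] := xP i (ltn_ord i); rewrite valK => nP; exists n.
  have /andP[t1 t2] := truncn_itv (mulr_ge0 (ltW q0) x0).
  set t := (Num.truncn _)%:R in t1 t2 *.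
  have d1 : `|B%:R ^+ i * x - s * v l i / (2 * pi) - n%:~R| <= del / 2.
    by apply: (le_trans nP); apply: n1P; rewrite -[X in (X < _)%N]addn0 ltn_add2l.
  have d2 : `|t * B%:R ^+ i / q%:R - B%:R ^+ i * x| <= del / 2.
    have -> : t * B%:R ^+ i / q%:R - B%:R ^+ i * x
       = B%:R ^+ i * ((t - q%:R * x) * q%:R^-1) by field; rewrite gt_eqF.
    rewrite normrM [`|B%:R ^+ i|]ger0_norm ?exprn_ge0 ?(ltW B0) //.
    apply: (@le_trans _ _ (B%:R ^+ m * q%:R^-1)).
      apply: ler_pM; rewrite ?exprn_ge0 ?(ltW B0) //.
        by rewrite -!natrX ler_nat leq_pexp2l /B ?addn3 // ltnW.
      rewrite normrM [`|q%:R^-1|]ger0_norm ?invr_ge0 ?(ltW q0) //.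
      rewrite ler_piMl ?invr_ge0 ?(ltW q0) //.
      by move: t2; rewrite -natr1 -/t => t2; rewrite ler_norml; lra.
    rewrite mulrC -ler_pdivlMr ?exprn_gt0 //; apply: n2P.
    exact: leq_ltn_trans (leq_addr _ _) qbig.
  have -> : t * B%:R ^+ i / q%:R - s * v l i / (2 * pi) - n%:~R =
    (t * B%:R ^+ i / q%:R - B%:R ^+ i * x) + (B%:R ^+ i * x - s * v l i / (2 * pi) - n%:~R)
    by ring.
  apply: (le_trans (ler_normD _ _)); lra.
move=> i j; have := approx_cyc_angle i j q_prime tauP.
set C := cos (cyc_angle _ _ _); set D := v l i - v l j => CD.
have -> : s ^- 2 * (2 - 2 * C) - D ^+ 2 =
   s ^- 2 * (2 * (cos (s * D) - C) + (2 - 2 * cos (s * D) - (s * D) ^+ 2)).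
  by field; rewrite gt_eqF.
rewrite normrM ger0_norm ?invr_ge0 ?exprn_ge0 ?(ltW s0) //.
rewrite mulrC ler_pdivrMr ?exprn_gt0 //.
apply: (le_trans (ler_normD _ _)).
have e1 : `|2 * (cos (s * D) - C)| <= eps / 2 * s ^+ 2.
  rewrite normrM ger0_norm // distrC.
  have -> : eps / 2 * s ^+ 2 = 2 * (4 * pi * del).
    have : pi != 0 :> R by rewrite gt_eqF.
    by rewrite /del; move: (@pi R) => p p0; field.
  by rewrite ler_wpM2l.
have e2 : `|2 - 2 * cos (s * D) - (s * D) ^+ 2| <= eps / 2 * s ^+ 2.
  apply: (le_trans (norm_cos_quadratic _)); rewrite normrM ger0_norm ?(ltW s0) //.
  have -> : eps / 2 * s ^+ 2 = (s * W) ^+ 3.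
    by rewrite /s; field; rewrite gt_eqF.
  apply: lerXn2r.
  - by rewrite nnegrE (mulr_ge0 (ltW s0)).
  - by rewrite nnegrE (mulr_ge0 (ltW s0)) // ltW.
  by apply: ler_wpM2l; [exact: ltW|exact: vW].
by apply: (le_trans (lerD e1 e2)); rewrite -mulrDl; lra.
Qed.

End Approximation.

(* [z i] is the gradient of the [i]-th barycentric coordinate. *)
Lemma barycentric_gradients (R : realType) k (X : seq 'rV[R]_k) :
  affinely_independent X -> exists z : 'I_(size X) -> 'rV[R]_k,
    forall i j : 'I_(size X), i != j ->
    \sum_t (X`_i ord0 t - X`_j ord0 t) * (z i ord0 t - z j ord0 t) = 2.
Proof.
move=> [_ indep]; set m := size X in indep *.
pose A : 'M[R]_(m, k) := \matrix_(i, t) X`_i ord0 t.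
(* The column of ones turns affine into linear independence of the rows; a right inverse then holds
   the gradients and constant terms of the barycentric coordinates. *)
pose M : 'M[R]_(m, k + 1) := row_mx A (const_mx 1).
have Mfree : row_free M.
  rewrite -kermx_eq0; apply/eqP/row_matrixP => i; rewrite row0.
  have := mulmx_ker M => /(congr1 (row i)); rewrite row_mul row0.
  set u := row i _; rewrite /M mul_mx_row -[RHS]row_mx0 => /eq_row_mx[uA u1].
  apply/rowP => j; rewrite [RHS]mxE.
  apply: (indep (fun j => u ord0 j)) => //.
    have /matrixP/(_ ord0 ord0) := u1; rewrite !mxE => e.
    by rewrite -[RHS]e; apply: eq_bigr => l _; rewrite !mxE mulr1.
  apply/rowP => t; have /matrixP/(_ ord0 t) := uA; rewrite !mxE => e.
  by rewrite summxE -[RHS]e; apply: eq_bigr => l _; rewrite !mxE.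
have /row_freeP[B MB] := Mfree.
exists (fun i => \row_t (usubmx B) t i) => i j ij.
have dual (a c : 'I_m) : \sum_t X`_a ord0 t * usubmx B t c + dsubmx B ord0 c = (a == c)%:R.
  have /matrixP/(_ a c) := MB; rewrite -{1}(vsubmxK B) mul_row_col !mxE => e.
  rewrite -[RHS]e; congr (_ + _).
    by apply: eq_bigr => t _; rewrite !mxE.
  by rewrite big_ord1 !mxE mul1r.
have -> : \sum_t (X`_i ord0 t - X`_j ord0 t) *
      ((\row_t0 usubmx B t0 i) ord0 t - (\row_t0 usubmx B t0 j) ord0 t)
  = (i == i)%:R - (i == j)%:R - ((j == i)%:R - (j == j)%:R) :> R.
  rewrite -!dual !opprD !addrA.
  have -> : \sum_t (X`_i ord0 t - X`_j ord0 t) *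
      ((\row_t0 usubmx B t0 i) ord0 t - (\row_t0 usubmx B t0 j) ord0 t) =
     \sum_t X`_i ord0 t * usubmx B t i - \sum_t X`_i ord0 t * usubmx B t j
     - (\sum_t X`_j ord0 t * usubmx B t i - \sum_t X`_j ord0 t * usubmx B t j).
    rewrite -!sumrB; apply: eq_bigr => t _; rewrite [X in _ * (X - _)]mxE.
    by rewrite [X in _ * (_ - X)]mxE; ring.
  by ring.
by rewrite !eqxx (negPf ij) eq_sym (negPf ij) /=; ring.
Qed.

Lemma Fp_sidon (q B m : nat) (i j k l : 'I_m) :
  prime q -> (3 <= B)%N -> (2 * B ^ m < q)%N ->
  (B ^ i)%:R - (B ^ j)%:R = (B ^ k)%:R - (B ^ l)%:R :> 'F_q -> i != j ->
  i = k /\ j = l.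
Proof.
move=> q_prime B3 qB e ij.
have Bm (h : 'I_m) : (B ^ h <= B ^ m)%N.
  by rewrite leq_pexp2l // 1?ltnW //; apply: leq_trans B3.
have : (B ^ i)%:R + (B ^ l)%:R = (B ^ k)%:R + (B ^ j)%:R :> 'F_q.
  by rewrite -[(B ^ i)%:R](subrK (B ^ j)%:R) e; ring.
rewrite -!natrD => /(congr1 val) /=; rewrite !val_Fp_nat //.
have small h h' : (B ^ h <= B ^ m -> B ^ h' <= B ^ m -> B ^ h + B ^ h' < q)%N.
  by move=> hm hm'; apply: leq_ltn_trans qB; rewrite mul2n -addnn leq_add.
rewrite !modn_small ?small // => e'.
by have [ik lj] := expn_sidon B3 e' ij; split; apply: val_inj.
Qed.

Lemma simplex_orbit (R : realType) k (X : seq 'rV[R]_k) : affinely_independent X ->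
  exists (q : nat) (J : finType) (u : 'F_q -> J -> R) (b : 'I_(size X) -> 'F_q),
  [/\ prime q, (2 < q)%N,
      forall a a' c, \sum_j (u (a + c) j - u (a' + c) j) ^+ 2
                     = \sum_j (u a j - u a' j) ^+ 2 &
      forall i i' : 'I_(size X), \sum_j (u (b i) j - u (b i') j) ^+ 2
                   = \sum_t (X`_i ord0 t - X`_i' ord0 t) ^+ 2].
Proof.
move=> /barycentric_gradients[z]; set m := size X => zP.
suff [q [b [D [q_prime q2 [J [u uD]] DX]]]] : exists q (b : 'I_m -> 'F_q) D,
    [/\ prime q, (2 < q)%N, @orbit_metric R q D & forall i i' : 'I_m, i != i' ->
      D (b i - b i') = \sum_t (X`_i ord0 t - X`_i' ord0 t) ^+ 2].
  exists q, J, u, b; split=> // [a a' c|i i'].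
    by rewrite !uD opprD addrACA subrr addr0.
  case: (eqVneq i i') => [->|ii]; last by rewrite uD DX.
  by rewrite !big1 // => *; rewrite subrr expr0n.
pose dX (i j : 'I_m) := \sum_t (X`_i ord0 t - X`_j ord0 t) ^+ 2.
pose dz (i j : 'I_m) := \sum_t (z i ord0 t - z j ord0 t) ^+ 2.
pose Z := 1 + \sum_i \sum_j dz i j.
have dz0 i j : 0 <= dz i j by apply: sumr_ge0 => t _; apply: sqr_ge0.
have Z0 : 0 < Z by rewrite ltr_pwDl // sumr_ge0 // => i _; apply: sumr_ge0.
have dzZ i j : dz i j <= Z.
  have le_sum (I : finType) (f : I -> R) x : (forall y, 0 <= f y) -> f x <= \sum_y f y.
    by move=> f0; rewrite (bigD1 x) //= lerDl sumr_ge0.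
  apply: (@le_trans _ _ (\sum_i \sum_j dz i j)); last by rewrite lerDr.
  apply: le_trans (le_sum _ _ i _) => [|i']; last exact: sumr_ge0.
  exact: le_sum.
(* [M] counts the summands of [D2]: one for each pair, and [cst], which keeps [M] positive for empty
   [X]. The constants are tuned so that [kappa * (2 * M) = 4 * eta], [eta ^ 2 * Z = kappa] and
   [K * eps = kappa]. *)
pose M : R := m%:R ^+ 2 + 1.
have M0 : 0 < M by rewrite ltr_wpDl // exprn_ge0.
pose eta := 2 / (M * Z).
have eta0 : 0 < eta by rewrite /eta divr_gt0 // mulr_gt0.
pose K : R := k%:R + 1.
have K0 : 0 < K by rewrite ltr_wpDl.
pose eps := 2 * eta / (M * K).
have eps0 : 0 < eps by rewrite /eps divr_gt0 // mulr_gt0.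
(* Moving each vertex along its gradient decreases all squared distances by
   nearly the same amount [4 * eta]. *)
pose v (t : 'I_k) (i : 'I_m) := X`_i ord0 t - eta * z i ord0 t.
have dv i j : i != j ->
    \sum_t (v t i - v t j) ^+ 2 = dX i j - 4 * eta + eta ^+ 2 * dz i j.
  move=> ij; rewrite (_ : 4 * eta = 2 * eta * 2); last by ring.
  rewrite -{2}(zP i j ij) /dX /dz !mulr_sumr -sumrB -big_split /=.
  by apply: eq_bigr => t _; rewrite /v; ring.
have [B [q [B3 q_prime qB approx]]] := cyclic_approx v eps0.
have [c cP] := choice approx; have [tau tauP] := choice cP.
pose b (i : 'I_m) : 'F_q := (B ^ i)%:R.
have sidon i j k' l : b i - b j = b k' - b l -> i != j -> i = k' /\ j = l.
  exact: Fp_sidon q_prime B3 qB.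
pose D1 (s : 'F_q) := \sum_t c t * (2 - 2 * cos (cyc_angle q (tau t) (s : nat)%:R)).
have D1_orbit : orbit_metric D1.
  apply: orbit_metric_sum => t; apply: orbit_metricZ; first by case: (tauP t).
  exact: orbit_metric_cos.
have D1v i j : `|D1 (b i - b j) - \sum_t (v t i - v t j) ^+ 2| <= K * eps.
  rewrite /D1 -sumrB; apply: (le_trans (ler_norm_sum _ _ _)).
  apply: (@le_trans _ _ (\sum_(t < k) eps)).
    by apply: ler_sum => t _; have [_] := tauP t; apply.
  by rewrite sumr_const card_ord -mulr_natl ler_pM2r // lerDl.
pose E i j := dX i j - D1 (b i - b j).
have E_sym i j : E i j = E j i.
  have dX_sym : dX i j = dX j i by apply: eq_bigr => t _; rewrite -sqrrN opprB.
  rewrite /E dX_sym; congr (_ - _); have [J [u uD]] := D1_orbit.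
  by rewrite -!uD; apply: eq_bigr => t _; rewrite -sqrrN opprB.
pose kappa := 4 * eta / (2 * M).
have kappa0 : 0 < kappa by rewrite /kappa divr_gt0 // mulr_gt0.
have E_near i j : i != j -> `|4 * eta - E i j| <= 2 * kappa.
  move=> ij; have := D1v i j; rewrite dv // => d1.
  have KE : K * eps = kappa by rewrite /eps /kappa; field; rewrite !gt_eqF.
  have ZE : eta ^+ 2 * dz i j <= kappa.
    have -> : kappa = eta ^+ 2 * Z by rewrite /kappa /eta; field; rewrite !gt_eqF.
    by rewrite ler_wpM2l // exprn_ge0 // ltW.
  have ZE0 : 0 <= eta ^+ 2 * dz i j by rewrite mulr_ge0 // exprn_ge0 // ltW.
  by move: d1; rewrite KE !ler_norml /E; lra.
have b_neq i j : i != j -> b i - b j != 0.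
  move=> ij; apply/eqP => e; have [] := sidon i j j j _ ij; first by rewrite e subrr.
  by move=> ij'; rewrite ij' eqxx in ij.
(* A pair and its reverse contribute equally, so the correction is divided by [4 * kappa]; the error
   bound [2 * kappa] keeps it within [1 / 2]. Diagonal pairs give the constant metric 2 off zero. *)
pose gam (p : 'I_m * 'I_m) :=
  if p.1 == p.2 then 0 else (4 * eta - E p.1 p.2) / (4 * kappa).
pose t0 (p : 'I_m * 'I_m) := if p.1 == p.2 then 1 else b p.1 - b p.2.
pose G p (t : 'F_q) : R := if t == 0 then 0
  else 2 - 2 * gam p * ((t == t0 p)%:R + (- t == t0 p)%:R).
have G_orbit p : orbit_metric (G p).
  case: p => i j; apply: orbit_metric_pair; rewrite /t0 /gam /=;
    case: (eqVneq i j) => [_|ij]; rewrite ?oner_neq0 //.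
  - exact: b_neq.
  - by rewrite normr0 divr_ge0.
  have k4 : 0 < 4 * kappa by apply: (mulr_gt0 _ kappa0).
  rewrite normrM [X in _ * X]ger0_norm ?invr_ge0 ?(ltW k4) // ler_pdivrMr //.
  by apply: (le_trans (E_near i j ij)); lra.
pose cst (t : 'F_q) : R :=
  if t == 0 then 0 else 2 - 2 * 0 * ((t == 1)%:R + (- t == 1)%:R).
have cst_orbit : orbit_metric cst.
  by apply: orbit_metric_pair; [exact: oner_neq0|rewrite normr0 divr_ge0].
pose D2 (t : 'F_q) := kappa * (cst t + \sum_p G p t).
have D2_orbit : orbit_metric D2.
  apply: orbit_metricZ; first exact: ltW.
  exact: (orbit_metricD cst_orbit (orbit_metric_sum G_orbit)).
have sum1 (x : 'I_m * 'I_m) : \sum_p (p == x)%:R = 1 :> R.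
  by rewrite (bigD1 x) //= eqxx big1 ?addr0 // => p /negPf ->.
have D2E i j : i != j -> D2 (b i - b j) = E i j.
  move=> ij; rewrite /D2 /cst (negPf (b_neq i j ij)) mulr0 mul0r subr0.
  (* By the Sidon property only [(i, j)] and [(j, i)] can move the value at [b i - b j] away from
     2. *)
  have GE p : G p (b i - b j) =
      2 - 2 * gam (i, j) * ((p == (i, j))%:R + (p == (j, i))%:R).
    rewrite /G (negPf (b_neq i j ij)) -!mulrA; congr (2 - 2 * _).
    case: p => k' l; rewrite /gam /t0 /= !xpair_eqE (negPf ij).
    case: (eqVneq k' l) => [<-|kl].
      have kij : (k' == i) && (k' == j) = false.
        by apply/andP => -[/eqP -> /eqP e]; rewrite e eqxx in ij.
      by rewrite [(k' == j) && _]andbC kij /= addr0 mulr0 mul0r.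
    have -> : (b i - b j == b k' - b l) = (k' == i) && (l == j).
      apply/eqP/andP => [e|[/eqP -> /eqP ->] //].
      by have [-> ->] := sidon _ _ _ _ e ij.
    have -> : (- (b i - b j) == b k' - b l) = (k' == j) && (l == i).
      rewrite opprB; apply/eqP/andP => [e|[/eqP -> /eqP ->] //].
      by rewrite eq_sym in ij; have [-> ->] := sidon _ _ _ _ e ij.
    case: (boolP ((k' == i) && (l == j))) => [/andP[/eqP -> /eqP ->] //|_].
    case: (boolP ((k' == j) && (l == i))) => [/andP[/eqP -> /eqP ->]|_].
      by rewrite E_sym.
    by rewrite addr0 !mulr0.
  rewrite (eq_bigr _ (fun p _ => GE p)) sumrB sumr_const -mulr_sumr big_split /= !sum1.
  rewrite card_prod card_ord /gam /= (negPf ij).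
  have -> : 2 *+ (m * m) = 2 * m%:R ^+ 2 :> R by rewrite -mulr_natr natrM; ring.
  have -> : kappa * (2 + (2 * m%:R ^+ 2 - 2 * ((4 * eta - E i j) / (4 * kappa)) * (1 + 1)))
    = kappa * (2 * M) - (4 * eta - E i j) by rewrite /M; field; rewrite gt_eqF.
  have -> : kappa * (2 * M) = 4 * eta by rewrite /kappa; field; rewrite gt_eqF.
  by ring.
exists q, b, (fun t => D1 t + D2 t); split=> //.
- apply: leq_ltn_trans qB; rewrite -[X in (X <= _)%N]muln1 leq_mul2l /=.
  by rewrite expn_gt0 (leq_trans _ B3).
- exact: orbit_metricD.
by move=> i j ij; rewrite D2E // addrC subrK.
Qed.

Lemma sqr_sum_orthogonal (R : realType) (I : finType) (s w : I -> R) :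
  (forall b b', b != b' -> s b * s b' = 0) ->
  (\sum_b s b * w b) ^+ 2 = \sum_b s b ^+ 2 * w b ^+ 2.
Proof.
move=> s0; rewrite expr2 mulr_suml; apply: eq_bigr => b _.
rewrite mulr_sumr (bigD1 b) //= big1 => [|b' bb']; first by ring.
by rewrite mulrACA s0 1?eq_sym // mul0r.
Qed.

(** * Isometric copies of the orbit over the join *)

Section OrbitMap.
Variables (R : realType) (q N : nat) (J : finType) (u : 'F_q -> J -> R).
Notation V := 'rV[R]_#|{: 'I_N.+1 * 'F_q}|.

(* For [x] in the join, [c |-> orbit_map (join_shift c x)] is an isometric copy
   of [u], since [\sum_i x_(i, b_i) = 1]. *)
Definition orbit_map (x : V) : 'rV[R]_#|{: 'I_N.+1 * J}| :=
  \row_k \sum_b Num.sqrt (jcoord x ((enum_val k).1, b)) * u b (enum_val k).2.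

Lemma orbit_map_continuous : continuous orbit_map.
Proof.
apply: continuous_row => k x; under eq_fun do rewrite mxE.
apply: continuous_big => [|b _]; first exact: add_continuous.
have sqrt_cont (t : 'I_N.+1 * 'F_q) : continuous (fun y : V => Num.sqrt (jcoord y t)).
  move=> y; exact: (continuous_comp (@jcoord_continuous R q N t y) (@sqrt_continuous R _)).
move=> y; exact: (cvgM (sqrt_cont ((enum_val k).1, b) y) (cvg_cst (u b (enum_val k).2))).
Qed.

Hypothesis u_stationary : forall a a' c,
  \sum_j (u (a + c) j - u (a' + c) j) ^+ 2 = \sum_j (u a j - u a' j) ^+ 2.

(** In each copy [i] at most one [b] has a nonzero coordinate, so cross terms vanish and the square
    roots become weights [jcoord x (i, b)]. The weighted terms agree by stationarity, and the
    weights sum to 1. *)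
Lemma orbit_map_dist (x : V) (c c' : 'F_q) : join x ->
  eucl_dist (orbit_map (join_shift c x)) (orbit_map (join_shift c' x))
  = Num.sqrt (\sum_j (u c j - u c' j) ^+ 2).
Proof.
move=> [x0 x1 x2]; congr Num.sqrt.
pose s i b := Num.sqrt (jcoord x (i, b)).
have shifted a (p : 'I_N.+1 * J) :
    orbit_map (join_shift a x) ord0 (enum_rank p) = \sum_b s p.1 b * u (b + a) p.2.
  rewrite mxE enum_rankK (reindex_inj (addIr a)) /=; apply: eq_bigr => b _.
  by rewrite join_shiftE addrK.
rewrite (reindex enum_rank) /=; last exact: onW_bij (enum_rank_bij _).
transitivity (\sum_(p : 'I_N.+1 * J)
    \sum_b jcoord x (p.1, b) * (u (b + c) p.2 - u (b + c') p.2) ^+ 2).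
  apply: eq_bigr => p _; rewrite !shifted -sumrB.
  under eq_bigr do rewrite -mulrBr.
  rewrite sqr_sum_orthogonal => [|b b' bb']; last by rewrite -sqrtrM // x2 // sqrtr0.
  by apply: eq_bigr => b _; rewrite sqr_sqrtr.
rewrite -(pair_bigA _ (fun i j =>
  \sum_b jcoord x (i, b) * (u (b + c) j - u (b + c') j) ^+ 2)) /=.
transitivity (\sum_i \sum_b jcoord x (i, b) * \sum_j (u c j - u c' j) ^+ 2).
  apply: eq_bigr => i _; rewrite exchange_big /=; apply: eq_bigr => b _.
  by rewrite -mulr_sumr [b + c]addrC [b + c']addrC u_stationary.
rewrite pair_bigA /= -mulr_suml -[RHS]mul1r -x1.
by congr (_ * _); apply: eq_bigr => -[].
Qed.

End OrbitMap.

Theorem theorem7 (R : realType) (k : nat) (X : seq 'rV[R]_k) (d : nat) :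
  affinely_independent X -> (0 < d)%N ->
  exists n : nat,
    forall f : 'rV[R]_n -> 'rV[R]_d, continuous f ->
      exists g : 'rV[R]_k -> 'rV[R]_n,
        (forall x y, x \in X -> y \in X -> eucl_dist (g x) (g y) = eucl_dist x y) /\
        (forall x y, x \in X -> y \in X -> f (g x) = f (g y)).
Proof.
move=> indep d0.
have [q [J [u [b [q_prime q2 u_stat uX]]]]] := simplex_orbit indep.
pose N := #|{: 'I_d * 'I_q}|.
exists #|{: 'I_N.+1 * J}| => f f_cont.
have h_cont : continuous (f \o @orbit_map R q N J u).
  by move=> x; apply: continuous_comp; [exact: orbit_map_continuous|exact: f_cont].
have [x xE hx] := join_borsuk_ulam q_prime q2 d0 h_cont.
(* Vertices go to their positions in the orbit; the value 0 outside [X] is arbitrary. *)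
pose pos y : 'F_q := if insub (index y X) is Some i then b i else 0.
exists (fun y => orbit_map u (join_shift (pos y) x)); split=> y z yX zX.
  rewrite orbit_map_dist // /pos.
  have yi : (index y X < size X)%N by rewrite index_mem.
  have zi : (index z X < size X)%N by rewrite index_mem.
  by rewrite !insubT uX /eucl_dist /= !nth_index.
exact: (etrans (hx (pos y)) (esym (hx (pos z)))).
Qed.
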